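(* Let $k$ be a field of characteristic zero, let $\Delta$ be the monochromatic triangle with vertex set partitioned as $\{1\}\sqcup\{2\}\sqcup\{3\}$, let $B=k e_1\oplus k e_2\oplus k e_3$, and let $\mathcal{B}(\Delta)$ be its Boalch algebra (presented explicitly in the context). Define a $B$-linear double bracket $\{\!\{-,-\}\!\}$ on $\mathcal{B}(\Delta)$ by setting, on the generators $v_{ij}$ ($i\neq j$ in $\{1,2,3\}$), $\{\!\{v_{ij},v_{ij}\}\!\}=0$ and \begin{align*} \{\!\{v_{12},v_{13}\}\!\}&=\tfrac12 v_{12}\otimes v_{13}, & \{\!\{v_{12},v_{32}\}\!\}&=\tfrac12 v_{32}\otimes v_{12},\\ \{\!\{v_{21},v_{31}\}\!\}&=-\tfrac12 v_{31}\otimes v_{21}, & \{\!\{v_{21},v_{23}\}\!\}&=-\tfrac12 v_{21}\otimes v_{23},\\ \{\!\{v_{13},v_{23}\}\!\}&=\tfrac12 v_{23}\otimes v_{13}, & \{\!\{v_{13},v_{32}\}\!\}&=-\tfrac12 e_3\otimes v_{13}v_{32},\\ \{\!\{v_{31},v_{23}\}\!\}&=\tfrac12 v_{23}v_{31}\otimes e_3, & \{\!\{v_{31},v_{32}\}\!\}&=-\tfrac12 v_{31}\otimes v_{32}, \end{align*} \begin{align*} \{\!\{v_{12},v_{21}\}\!\}&=-e_2\otimes e_1-\tfrac12\big(e_2\otimes v_{12}v_{21}+v_{21}v_{12}\otimes e_1\big),\\ \{\!\{v_{12},v_{31}\}\!\}&=-\tfrac12 v_{31}v_{12}\otimes e_1-v_{32}\otimes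 e_1,\\ \{\!\{v_{12},v_{23}\}\!\}&=-\tfrac12 e_2\otimes v_{12}v_{23}+e_2\otimes v_{13},\\ \{\!\{v_{21},v_{13}\}\!\}&=\tfrac12 e_1\otimes v_{21}v_{13}+e_1\otimes v_{23},\\ \{\!\{v_{21},v_{32}\}\!\}&=\tfrac12 v_{32}v_{21}\otimes e_2-v_{31}\otimes e_2,\\ \{\!\{v_{13},v_{31}\}\!\}&=-e_3\otimes e_1-v_{32}v_{23}\otimes e_1-\tfrac12\big(e_3\otimes v_{13}v_{31}+v_{31}v_{13}\otimes e_1\big),\\ \{\!\{v_{23},v_{32}\}\!\}&=-e_3\otimes e_2-\tfrac12\big(e_3\otimes v_{23}v_{32}+v_{32}v_{23}\otimes e_2\big), \end{align*} and by using the cyclic antisymmetry and the Leibniz rule. Let $\Phi:=\gamma_1+\gamma_2+\gamma_3$. Then the triple $\big(\mathcal{B}(\Delta),\{\!\{-,-\}\!\},\Phi\big)$ is a Hamiltonian double quasi-Poisson algebra.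
   Context: The algebra $\mathcal{B}(\Delta)$. It is the associative unital $k$-algebra generated by $e_1,e_2,e_3$, $v_{ij}$ and $w_{ij}$ ($i\ne j$ in $\{1,2,3\}$), and $\gamma_i^{\pm1}$ ($i=1,2,3$), subject to $1=e_1+e_2+e_3$, $e_ie_j=\delta_{ij}e_i$, $v_{ij}=e_iv_{ij}e_j$, $w_{ij}=e_iw_{ij}e_j$, $\gamma_i^{\pm1}=e_i\gamma_i^{\pm1}e_i$, $\gamma_i\gamma_i^{-1}=e_i=\gamma_i^{-1}\gamma_i$, and $$(1+v_{21}+v_{31}+v_{32})(1+v_{12}+v_{13}+v_{23})=(1+w_{12}+w_{13}+w_{23})(\gamma_1+\gamma_2+\gamma_3)(1+w_{21}+w_{31}+w_{32}).$$ It is a localization of the path algebra of the quiver with vertices $1,2,3$ and arrows $v_{ij}:j\to i$ ($i\neq j$; paths are read from right to left), so a $B$-linear double bracket on it is determined by its values on the $v_{ij}$. Double brackets. Write $\otimes=\otimes_k$. Let $I$ be a finite set and let $B=\bigoplus_{s\in I}k e_s$ with orthogonal idempotents $e_s$; let $A$ be an associative unital algebra with a unital morphism $B\to A$, so $1=\sum_s e_s$. A ($B$-linear) double bracket on $A$ is a $k$-bilinear map $\{\!\{-,-\}\!\}:A\times A\to A\otimes A$ that vanishes if an argument lies in (the image of) $B$ and satisfies, for all $a,b,c\in A$, $\{\!\{a,b\}\!\}=-\tau_{(12)}\{\!\{b,a\}\!\}$ (cyclic antisymmetry) and $\{\!\{a,bc\}\!\}=\{\!\{a,b\}\!\}c+b\{\!\{a,c\}\!\}$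 (Leibniz rule), where $x(a'\otimes a'')y=xa'\otimes a''y$. Here $\tau_s(a_1\otimes\cdots\otimes a_n)=a_{s^{-1}(1)}\otimes\cdots\otimes a_{s^{-1}(n)}$ for a permutation $s$. Put $\{\!\{a,b\otimes c\}\!\}_L=\{\!\{a,b\}\!\}\otimes c$ and $$\{\!\{a,b,c\}\!\}=\{\!\{a,\{\!\{b,c\}\!\}\}\!\}_L+\tau_{(123)}\{\!\{b,\{\!\{c,a\}\!\}\}\!\}_L+\tau_{(132)}\{\!\{c,\{\!\{a,b\}\!\}\}\!\}_L,$$ \begin{align*}\{\!\{a,b,c\}\!\}_{\mathrm{qP}}=\tfrac14\sum_{s\in I}\big(&ce_sa\otimes e_sb\otimes e_s-ce_sa\otimes e_s\otimes be_s-ce_s\otimes ae_sb\otimes e_s+ce_s\otimes ae_s\otimes be_s\\&-e_sa\otimes e_sb\otimes e_sc+e_sa\otimes e_s\otimes be_sc+e_s\otimes ae_sb\otimes e_sc-e_s\otimes ae_s\otimes be_sc\big).\end{align*} The double bracket is quasi-Poisson if $\{\!\{a,b,c\}\!\}=\{\!\{a,b,c\}\!\}_{\mathrm{qP}}$ for all $a,b,c\in A$. A multiplicative moment map is an invertible element $\Phi=\sum_{s\in I}\Phi_s$, $\Phi_s\in e_sAe_s$, with $\{\!\{\Phi_s,a\}\!\}=\frac12(ae_s\otimes\Phi_s-e_s\otimes\Phi_sa+a\Phi_s\otimes e_s-\Phi_s\otimes e_sa)$ for all $a\in A$, $s\in I$. A Hamiltonian double quasi-Poisson algebra is a triple $(A,\{\!\{-,-\}\!\},\Phi)$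 with $\{\!\{-,-\}\!\}$ a double quasi-Poisson bracket and $\Phi$ a multiplicative moment map. *)

(* Defs.v *)
From HB Require Import structures.
From mathcomp Require Import all_boot all_algebra.
From mathcomp Require Import finmap boolp.
From mathcomp.multinomials Require Import monalg.

Set Implicit Arguments.
Unset Strict Implicit.
Unset Printing Implicit Defensive.

Import GRing.Theory.

Local Open Scope ring_scope.
Local Open Scope quotient_scope.

Section Tensor.
Variables (k : fieldType) (U V : lmodType k).

Local Notation F := {malg k[(U * V)%type]}.

(* The submodule of the free module on U * V generated by the bilinearity
   relations. *)
Inductive bilin_span : F -> Prop :=
| bilin_Dl u u' v :
    bilin_span (<< (u + u', v) >> - (<< (u, v) >> + << (u', v) >>))
| bilin_Dr u v v' :
    bilin_span (<< (u, v + v') >> - (<< (u, v) >> + << (u, v') >>))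
| bilin_Zl c u v : bilin_span (<< (c *: u, v) >> - c *: << (u, v) >>)
| bilin_Zr c u v : bilin_span (<< (u, c *: v) >> - c *: << (u, v) >>)
| bilin_0 : bilin_span 0
| bilin_lin c x y : bilin_span x -> bilin_span y -> bilin_span (c *: x + y).

Definition bilin_rel : {pred F} := [pred x | `[< bilin_span x >]].

Fact bilin_relZ c x : x \in bilin_rel -> c *: x \in bilin_rel.
Proof.
move=> /asboolP bx; apply/asboolP; rewrite -[c *: x]addr0.
exact: bilin_lin bx bilin_0.
Qed.

Fact bilin_rel_zmod_closed : zmod_closed bilin_rel.
Proof.
split; first by apply/asboolP; exact: bilin_0.
move=> x y /asboolP bx /asboolP b_y; apply/asboolP.
by rewrite addrC -scaleN1r; exact: bilin_lin.
Qed.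

HB.instance Definition _ :=
  GRing.isZmodClosed.Build F bilin_rel bilin_rel_zmod_closed.

Definition tensor := Quotient.quot (bilin_rel : zmodClosed F).

HB.instance Definition _ := GRing.Zmodule.on tensor.
HB.instance Definition _ := EqQuotient.on tensor.

Fact tensor_eqP (x y : F) :
  reflect (\pi_tensor x = \pi_tensor y) (x - y \in bilin_rel).
Proof. by rewrite Quotient.idealrBE; apply: eqP. Qed.

Fact tensor_piD : {morph \pi_tensor : x y / x + y}.
Proof. exact: raddfD. Qed.

(* The operations are locked so that unification does not unfold them. *)
Fact tensor_key : unit. Proof. by []. Qed.

Definition tensor_scale : k -> tensor -> tensor :=
  locked_with tensor_key (fun c x => \pi_tensor (c *: repr x)).

Fact tensor_scaleE c x : tensor_scale c x = \pi_tensor (c *: repr x).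
Proof. by rewrite /tensor_scale; case: tensor_key. Qed.

Fact tensor_piZ c x : \pi_tensor (c *: x) = tensor_scale c (\pi_tensor x).
Proof.
rewrite tensor_scaleE.
by apply/tensor_eqP; rewrite -scalerBr; apply/bilin_relZ/tensor_eqP; rewrite reprK.
Qed.

Fact tensor_scaleA a b x :
  tensor_scale a (tensor_scale b x) = tensor_scale (a * b) x.
Proof. by elim/quotW: x => x; rewrite -(tensor_piZ b x) -!tensor_piZ scalerA. Qed.

Fact tensor_scale1 : left_id 1 tensor_scale.
Proof. by elim/quotW=> x; rewrite -tensor_piZ scale1r. Qed.

Fact tensor_scaleDr : right_distributive tensor_scale +%R.
Proof.
move=> c; elim/quotW=> x; elim/quotW=> y.
by rewrite -tensor_piD -(tensor_piZ c x) -(tensor_piZ c y) -tensor_piZ scalerDr tensor_piD.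
Qed.

Fact tensor_scaleDl x : {morph tensor_scale^~ x : a b / a + b}.
Proof.
by elim/quotW: x => x a b; rewrite -(tensor_piZ a x) -(tensor_piZ b x) -tensor_piZ scalerDl tensor_piD.
Qed.

HB.instance Definition _ := GRing.Zmodule_isLmodule.Build k tensor
  tensor_scaleA tensor_scale1 tensor_scaleDr tensor_scaleDl.

Definition tens : U -> V -> tensor :=
  locked_with tensor_key (fun u v => \pi_tensor << (u, v) >>).

Fact tensE u v : tens u v = \pi_tensor << (u, v) >>.
Proof. by rewrite /tens; case: tensor_key. Qed.

Lemma tensDl u u' v : tens (u + u') v = tens u v + tens u' v.
Proof. by rewrite !tensE -tensor_piD; apply/tensor_eqP/asboolP/bilin_Dl. Qed.

Lemma tensDr u v v' : tens u (v + v') = tens u v + tens u v'.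
Proof. by rewrite !tensE -tensor_piD; apply/tensor_eqP/asboolP/bilin_Dr. Qed.

Lemma tensZl c u v : tens (c *: u) v = c *: tens u v.
Proof. by rewrite !tensE -[RHS]tensor_piZ; apply/tensor_eqP/asboolP/bilin_Zl. Qed.

Lemma tensZr c u v : tens u (c *: v) = c *: tens u v.
Proof. by rewrite !tensE -[RHS]tensor_piZ; apply/tensor_eqP/asboolP/bilin_Zr. Qed.

End Tensor.

Definition bilin (k : fieldType) (U V W : lmodType k) (f : U -> V -> W) : Prop :=
  (forall v, linear (f^~ v)) /\ (forall u, linear (f u)).

(* The map on the tensor product induced by f; it is defined for an arbitrary f
   by means of a representative in the free module, and it is the linear map
   with [tlift f (tens u v) = f u v] when f is bilinear (see tlift_linear and
   tlift_tens). *)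
Definition tlift (k : fieldType) (U V W : lmodType k) (f : U -> V -> W)
    (x : tensor U V) : W :=
  \sum_(p <- msupp (repr x)) (repr x)@_p *: f p.1 p.2.

Section TensorLift.
Variables (k : fieldType) (U V W : lmodType k) (f : U -> V -> W).
Hypothesis bilf : bilin f.

Let ev (x : {malg k[(U * V)%type]}) : W :=
  \sum_(p <- msupp x) x@_p *: f p.1 p.2.

Let evw (d : {fset (U * V)%type}) x : fsubset (msupp x) d ->
  ev x = \sum_(p <- d) x@_p *: f p.1 p.2.
Proof.
move=> le; rewrite [LHS](big_fset_incl _ le) => //= p pd /mcoeff_outdom ->.
by rewrite scale0r.
Qed.

Let ev_linear : linear ev.
Proof.
move=> c x y; set d := fsetU (msupp x) (msupp y).
have lx : fsubset (msupp x) d by exact: fsubsetUl.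
have ly : fsubset (msupp y) d by exact: fsubsetUr.
rewrite (@evw d) ?(@evw d x) ?(@evw d y) //; last first.
  apply: fsubset_trans (msuppD_le _ _) _; rewrite fsubUset ly andbT.
  exact: fsubset_trans (msuppZ_le _ _) lx.
rewrite scaler_sumr -big_split /=; apply: eq_bigr => p _.
by rewrite mcoeffD mcoeffZ scalerDl scalerA.
Qed.

Let evU u v : ev << (u, v) >> = f u v.
Proof. by rewrite (evw msuppU_le) big_seq_fset1 mcoeffUU scale1r. Qed.

Let evD x y : ev (x + y) = ev x + ev y.
Proof. by have := ev_linear 1 x y; rewrite !scale1r. Qed.

Let ev0 : ev 0 = 0.
Proof. by rewrite /ev msupp0 big_seq_fset0. Qed.

Let evZ c x : ev (c *: x) = c *: ev x.
Proof. by have := ev_linear c x 0; rewrite ev0 !addr0. Qed.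

Let evB x y : ev (x - y) = ev x - ev y.
Proof. by rewrite evD -(scaleN1r y) evZ scaleN1r. Qed.

Let ev_span x : bilin_span x -> ev x = 0.
Proof.
case: bilf => fl fr.
have fDl u u' v : f (u + u') v = f u v + f u' v.
  by have := fl v 1 u u'; rewrite !scale1r.
have fDr u v v' : f u (v + v') = f u v + f u v'.
  by have := fr u 1 v v'; rewrite !scale1r.
have f0l v : f 0 v = 0 by apply: (addrI (f 0 v)); rewrite -fDl !addr0.
have f0r u : f u 0 = 0 by apply: (addrI (f u 0)); rewrite -fDr !addr0.
elim=> [u u' v|u v v'|c u v|c u v||c {}x y _ ex _ ey].
- by rewrite evB evD !evU fDl subrr.
- by rewrite evB evD !evU fDr subrr.
- by have := fl v c u 0; rewrite !addr0 f0l addr0 evB evZ !evU => ->; rewrite subrr.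
- by have := fr u c v 0; rewrite !addr0 f0r addr0 evB evZ !evU => ->; rewrite subrr.
- exact: ev0.
- by rewrite evD evZ ex ey scaler0 addr0.
Qed.

Let tlift_pi x : tlift f (\pi_(tensor U V) x) = ev x.
Proof.
rewrite -[LHS]/(ev (repr _)); apply/eqP; rewrite -subr_eq0 -evB; apply/eqP.
by apply/ev_span/asboolP/tensor_eqP; rewrite reprK.
Qed.

Lemma tlift_linear : linear (tlift f).
Proof.
move=> c; elim/quotW=> x; elim/quotW=> y.
by rewrite -[c *: _]tensor_piZ -tensor_piD !tlift_pi ev_linear.
Qed.

Lemma tlift_tens u v : tlift f (tens u v) = f u v.
Proof. by rewrite tensE tlift_pi evU. Qed.

End TensorLift.

Section DoubleBracket.
Variables (k : fieldType) (A : algType k) (I : finType).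

Notation tensor2 := (tensor A A).
Notation tensor3 := (tensor tensor2 A).

Definition tens3 (a b c : A) : tensor3 := tens (tens a b) c.

Definition outer (x : A) (t : tensor2) (y : A) : tensor2 :=
  tlift (fun a b => tens (x * a) (b * y)) t.

Definition tau12 : tensor2 -> tensor2 := tlift (fun a b => tens b a).

(* s = (1 2 3) has s^-1(1) = 3, s^-1(2) = 1, s^-1(3) = 2, so
   a1 (x) a2 (x) a3 is sent to a3 (x) a1 (x) a2; inversely for (1 3 2). *)
Definition tau123 : tensor3 -> tensor3 :=
  tlift (fun t c => tlift (fun a b => tens3 c a b) t).

Definition tau132 : tensor3 -> tensor3 :=
  tlift (fun t c => tlift (fun a b => tens3 b c a) t).

(* A unital algebra morphism from B, the direct sum of the k e_s, to A is given
   by the family of the images of the e_s. *)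
Definition orthogonal_idempotents (e : I -> A) : Prop :=
  (forall s t, e s * e t = if s == t then e s else 0) /\ \sum_s e s = 1.

Definition in_base (e : I -> A) (a : A) : Prop :=
  exists c : I -> k, a = \sum_s c s *: e s.

Record double_bracket (e : I -> A) (br : A -> A -> tensor2) : Prop := {
  br_bilin : bilin br;
  br_basel : forall a b, in_base e a -> br a b = 0;
  br_baser : forall a b, in_base e b -> br a b = 0;
  br_antisym : forall a b, br a b = - tau12 (br b a);
  br_leibniz : forall a b c,
    br a (b * c) = outer 1 (br a b) c + outer b (br a c) 1
}.

Definition brL (br : A -> A -> tensor2) (a : A) : tensor2 -> tensor3 :=
  tlift (fun b c => tens (br a b) c).

Definition triple_bracket (br : A -> A -> tensor2) (a b c : A) : tensor3 :=
  brL br a (br b c) + tau123 (brL br b (br c a)) + tau132 (brL br c (br a b)).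

Definition qP_bracket (e : I -> A) (a b c : A) : tensor3 :=
  4^-1 *: \sum_s
    (tens3 (c * e s * a) (e s * b) (e s)
     - tens3 (c * e s * a) (e s) (b * e s)
     - tens3 (c * e s) (a * e s * b) (e s)
     + tens3 (c * e s) (a * e s) (b * e s)
     - tens3 (e s * a) (e s * b) (e s * c)
     + tens3 (e s * a) (e s) (b * e s * c)
     + tens3 (e s) (a * e s * b) (e s * c)
     - tens3 (e s) (a * e s) (b * e s * c)).

Definition quasi_Poisson (e : I -> A) (br : A -> A -> tensor2) : Prop :=
  forall a b c, triple_bracket br a b c = qP_bracket e a b c.

Definition mult_moment_map (e : I -> A) (br : A -> A -> tensor2) (Phi : A)
    : Prop :=
  (exists Psi, Phi * Psi = 1 /\ Psi * Phi = 1) /\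
  exists Phi_ : I -> A,
    [/\ Phi = \sum_s Phi_ s,
        forall s, exists x, Phi_ s = e s * x * e s
      & forall a s, br (Phi_ s) a =
          2^-1 *: (tens (a * e s) (Phi_ s) - tens (e s) (Phi_ s * a)
                   + tens (a * Phi_ s) (e s) - tens (Phi_ s) (e s * a))].

Record Hamiltonian_dqP (e : I -> A) (br : A -> A -> tensor2) (Phi : A)
    : Prop := {
  H_base : orthogonal_idempotents e;
  H_double : double_bracket e br;
  H_qP : quasi_Poisson e br;
  H_moment : mult_moment_map e br Phi
}.

End DoubleBracket.

(* The vertices 1, 2, 3 are encoded as 0, 1, 2 : 'I_3. *)
Definition i1 : 'I_3 := @Ordinal 3 0 isT.
Definition i2 : 'I_3 := @Ordinal 3 1 isT.
Definition i3 : 'I_3 := @Ordinal 3 2 isT.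

Definition arrow : Type := {p : 'I_3 * 'I_3 | p.1 != p.2}.
HB.instance Definition _ := Finite.on arrow.

Definition arr i j (neq_ij : i != j) : arrow := exist _ (i, j) neq_ij.

Definition a12 := @arr i1 i2 isT.
Definition a13 := @arr i1 i3 isT.
Definition a21 := @arr i2 i1 isT.
Definition a23 := @arr i2 i3 isT.
Definition a31 := @arr i3 i1 isT.
Definition a32 := @arr i3 i2 isT.

(* Gen_ginv i stands for the formal inverse of gamma_i. *)
Inductive gen : Type :=
| Gen_e of 'I_3
| Gen_v of arrow
| Gen_w of arrow
| Gen_g of 'I_3
| Gen_ginv of 'I_3.

Definition gen_code (x : gen) : 'I_3 + arrow + arrow + 'I_3 + 'I_3 :=
  match x with
  | Gen_e i => inl (inl (inl (inl i)))
  | Gen_v a => inl (inl (inl (inr a)))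
  | Gen_w a => inl (inl (inr a))
  | Gen_g i => inl (inr i)
  | Gen_ginv i => inr i
  end.

Definition gen_decode (x : 'I_3 + arrow + arrow + 'I_3 + 'I_3) : gen :=
  match x with
  | inl (inl (inl (inl i))) => Gen_e i
  | inl (inl (inl (inr a))) => Gen_v a
  | inl (inl (inr a)) => Gen_w a
  | inl (inr i) => Gen_g i
  | inr i => Gen_ginv i
  end.

Fact gen_codeK : cancel gen_code gen_decode.
Proof. by case. Qed.

HB.instance Definition _ := Finite.copy gen (can_type gen_codeK).

(* The defining relations, for a family g of elements of a ring R indexed by the
   generators. *)
Section Relations.
Variables (R : nzRingType) (g : gen -> R).

Local Notation E i := (g (Gen_e i)).
Local Notation V a := (g (Gen_v a)).
Local Notation W a := (g (Gen_w a)).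
Local Notation G i := (g (Gen_g i)).
Local Notation Gi i := (g (Gen_ginv i)).

Inductive boalch_rel : R -> R -> Prop :=
| brel_unit : boalch_rel 1 (E i1 + E i2 + E i3)
| brel_e i j : boalch_rel (E i * E j) (if i == j then E i else 0)
| brel_v i j (ij : i != j) :
    boalch_rel (V (arr ij)) (E i * V (arr ij) * E j)
| brel_w i j (ij : i != j) :
    boalch_rel (W (arr ij)) (E i * W (arr ij) * E j)
| brel_g i : boalch_rel (G i) (E i * G i * E i)
| brel_ginv i : boalch_rel (Gi i) (E i * Gi i * E i)
| brel_gV i : boalch_rel (G i * Gi i) (E i)
| brel_Vg i : boalch_rel (Gi i * G i) (E i)
| brel_main : boalch_rel
    ((1 + V a21 + V a31 + V a32) * (1 + V a12 + V a13 + V a23))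
    ((1 + W a12 + W a13 + W a23) * (G i1 + G i2 + G i3)
      * (1 + W a21 + W a31 + W a32)).

End Relations.

Lemma boalch_rel_morph (R S : nzRingType) (f : {rmorphism R -> S})
    (g : gen -> R) x y :
  boalch_rel g x y -> boalch_rel (f \o g) (f x) (f y).
Proof.
case=> [|i j|i j ij|i j ij|i|i|i|i|]; rewrite ?(rmorphD, rmorphM, rmorph1).
- exact: (brel_unit (f \o g)).
- by rewrite (fun_if f) rmorph0; exact: (brel_e (f \o g)).
- exact: (brel_v (f \o g)).
- exact: (brel_w (f \o g)).
- exact: (brel_g (f \o g)).
- exact: (brel_ginv (f \o g)).
- exact: (brel_gV (f \o g)).
- exact: (brel_Vg (f \o g)).
- exact: (brel_main (f \o g)).
Qed.

Lemma boalch_rel_lift (R S : nzRingType) (f : {rmorphism R -> S})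
    (g : gen -> R) x y : boalch_rel (f \o g) x y ->
  exists p q, [/\ boalch_rel g p q, x = f p & y = f q].
Proof.
case=> [|i j|i j ij|i j ij|i|i|i|i|].
- by do 2!eexists; split; [exact: brel_unit | rewrite rmorph1 | rewrite !rmorphD].
- do 2!eexists; split; [exact: (brel_e g i j) | by rewrite rmorphM |].
  by rewrite (fun_if f) rmorph0.
- by do 2!eexists; split; [exact: (brel_v g ij) | | rewrite !rmorphM].
- by do 2!eexists; split; [exact: (brel_w g ij) | | rewrite !rmorphM].
- by do 2!eexists; split; [exact: (brel_g g i) | | rewrite !rmorphM].
- by do 2!eexists; split; [exact: (brel_ginv g i) | | rewrite !rmorphM].
- by do 2!eexists; split; [exact: (brel_gV g i) | rewrite rmorphM |].
- by do 2!eexists; split; [exact: (brel_Vg g i) | rewrite rmorphM |].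
- do 2!eexists; split; [exact: (brel_main g) | |];
    by rewrite !(rmorphM, rmorphD, rmorph1).
Qed.

Section Boalch.
Variable k : fieldType.

Local Notation freealg := {malg k[{fmonom gen}]}.

Fact freealg_scalerAr (c : k) (x y : freealg) : c *: (x * y) = x * (c *: y).
Proof.
have cx : c%:MP * x = x * c%:MP.
  rewrite [x]monalgE mulr_suml mulr_sumr; apply: eq_bigr => m _.
  by rewrite !malgM_def !fgmulUU mulm1 mul1m mulrC.
rewrite -[LHS]mul_malgC [LHS]mulrA cx -[LHS]mulrA (mul_malgC c y).
reflexivity.
Qed.

Fact fgen_key : unit. Proof. by []. Qed.
Definition fgen : gen -> freealg := locked_with fgen_key (fun x => << fmu x >>).
Fact fgenE x : fgen x = << fmu x >>. Proof. by rewrite /fgen; case: fgen_key. Qed.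

(* The two-sided ideal generated by the relations. *)
Inductive boalch_span : freealg -> Prop :=
| span_rel x y : boalch_rel fgen x y -> boalch_span (x - y)
| span_0 : boalch_span 0
| span_D x y : boalch_span x -> boalch_span y -> boalch_span (x + y)
| span_Ml x y : boalch_span y -> boalch_span (x * y)
| span_Mr x y : boalch_span x -> boalch_span (x * y).

Definition boalch_ideal : {pred freealg} := [pred x | `[< boalch_span x >]].

Fact boalch_ideal_zmod_closed : zmod_closed boalch_ideal.
Proof.
split; first by apply/asboolP; exact: span_0.
move=> x y /asboolP bx /asboolP b_y; apply/asboolP.
by rewrite -mulN1r; apply: span_D => //; exact: span_Ml.
Qed.

HB.instance Definition _ :=
  GRing.isZmodClosed.Build freealg boalch_ideal boalch_ideal_zmod_closed.

Fact boalch_idealMl x y : y \in boalch_ideal -> x * y \in boalch_ideal.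
Proof. by move=> /asboolP b; apply/asboolP/span_Ml. Qed.

Fact boalch_idealMr x y : x \in boalch_ideal -> x * y \in boalch_ideal.
Proof. by move=> /asboolP b; apply/asboolP/span_Mr. Qed.

Lemma boalch_span_morph (S : nzRingType) (f : {rmorphism freealg -> S}) :
  (forall x y, boalch_rel (f \o fgen) x y -> x = y) ->
  forall x, boalch_span x -> f x = 0.
Proof.
move=> f_rel x; elim=> [{}x y /(boalch_rel_morph f) /f_rel fxy||||].
- by rewrite rmorphB fxy subrr.
- exact: rmorph0.
- by move=> {}x y _ fx _ fy; rewrite rmorphD fx fy addr0.
- by move=> {}x y _ fy; rewrite rmorphM fy mulr0.
- by move=> {}x y _ fx; rewrite rmorphM fx mul0r.
Qed.

Definition boalch := Quotient.quot (boalch_ideal : zmodClosed freealg).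

HB.instance Definition _ := GRing.Zmodule.on boalch.
HB.instance Definition _ := EqQuotient.on boalch.

Fact boalch_eqP (x y : freealg) :
  reflect (\pi_boalch x = \pi_boalch y) (x - y \in boalch_ideal).
Proof. by rewrite Quotient.idealrBE; apply: eqP. Qed.

Fact boalch_piD : {morph \pi_boalch : x y / x + y}.
Proof. exact: raddfD. Qed.

Fact boalch_key : unit. Proof. by []. Qed.

Definition boalch_one : boalch := locked_with boalch_key (\pi_boalch 1).
Definition boalch_mul : boalch -> boalch -> boalch :=
  locked_with boalch_key (fun x y => \pi_boalch (repr x * repr y)).
Definition boalch_scale : k -> boalch -> boalch :=
  locked_with boalch_key (fun c x => \pi_boalch (c *: repr x)).

Fact boalch_mulE x y : boalch_mul x y = \pi_boalch (repr x * repr y).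
Proof. by rewrite /boalch_mul; case: boalch_key. Qed.

Fact boalch_scaleE c x : boalch_scale c x = \pi_boalch (c *: repr x).
Proof. by rewrite /boalch_scale; case: boalch_key. Qed.

Fact boalch_pi1 : \pi_boalch 1 = boalch_one.
Proof. by rewrite /boalch_one; case: boalch_key. Qed.

Fact boalch_piM x y :
  \pi_boalch (x * y) = boalch_mul (\pi_boalch x) (\pi_boalch y).
Proof.
rewrite boalch_mulE.
set x' := repr (\pi_boalch x); set y' := repr (\pi_boalch y).
have hx : x - x' \in boalch_ideal by apply/boalch_eqP; rewrite reprK.
have hy : y - y' \in boalch_ideal by apply/boalch_eqP; rewrite reprK.
apply/boalch_eqP; rewrite -/x' -/y'.
have -> : x * y - x' * y' = (x - x') * y + x' * (y - y').
  by rewrite mulrBl mulrBr addrA subrK.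
by apply: rpredD; [exact: boalch_idealMr | exact: boalch_idealMl].
Qed.

Fact boalch_piZ c x : \pi_boalch (c *: x) = boalch_scale c (\pi_boalch x).
Proof.
rewrite boalch_scaleE.
apply/boalch_eqP; rewrite -scalerBr -mul_malgC; apply: boalch_idealMl.
by apply/boalch_eqP; rewrite reprK.
Qed.

Fact boalch_mulA : associative boalch_mul.
Proof.
elim/quotW=> x; elim/quotW=> y; elim/quotW=> z.
by rewrite -(boalch_piM y z) -(boalch_piM x y) -!boalch_piM mulrA.
Qed.

Fact boalch_mul1 : left_id boalch_one boalch_mul.
Proof. by elim/quotW=> x; rewrite -boalch_pi1 -boalch_piM mul1r. Qed.

Fact boalch_mulr1 : right_id boalch_one boalch_mul.
Proof. by elim/quotW=> x; rewrite -boalch_pi1 -boalch_piM mulr1. Qed.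

Fact boalch_mulDl : left_distributive boalch_mul +%R.
Proof.
elim/quotW=> x; elim/quotW=> y; elim/quotW=> z.
by rewrite -(boalch_piM x z) -(boalch_piM y z) -!boalch_piD -boalch_piM mulrDl.
Qed.

Fact boalch_mulDr : right_distributive boalch_mul +%R.
Proof.
elim/quotW=> x; elim/quotW=> y; elim/quotW=> z.
by rewrite -(boalch_piM x y) -(boalch_piM x z) -!boalch_piD -boalch_piM mulrDr.
Qed.

(* The algebra is nonzero: it has the one-dimensional representation
   concentrated at the vertex 1 with e_1 and gamma_1 acting as 1. *)
Let chi (x : gen) : k :=
  match x with
  | Gen_e i | Gen_g i | Gen_ginv i => (i == i1)%:R
  | _ => 0
  end.

Let chim (m : {fmonom gen}) : k := \prod_(x <- (m : seq gen)) chi x.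

Let chim_morph : mmorphism chim.
Proof. by split=> [m m'|]; rewrite /chim ?fm1 ?big_nil // fmM big_cat. Qed.

HB.instance Definition _ :=
  isMultiplicative.Build {fmonom gen} k chim chim_morph.

Let rep : {rmorphism freealg -> k} := mmap idfun chim.

Let rep_gen x : rep (fgen x) = chi x.
Proof.
rewrite fgenE [LHS]mmapU /= mul1r /chim.
by rewrite (_ : fmu x = [:: x] :> seq gen) ?big_seq1 // fmU.
Qed.

Let chi_rel x y : boalch_rel chi x y -> x = y.
Proof.
case=> [|i j|i j ij|i j ij|i|i|i|i|] /=.
- by rewrite !addr0.
- case: (eqVneq i j) => [<-|neq_ij]; first by rewrite -natrM mulnb andbb.
  rewrite -natrM mulnb; have [i_1|] //= := eqVneq i i1.
  by have [j_1|] //= := eqVneq j i1; rewrite i_1 j_1 in neq_ij.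
- by rewrite mulr0 mul0r.
- by rewrite mulr0 mul0r.
- by rewrite -!natrM !mulnb !andbb.
- by rewrite -!natrM !mulnb !andbb.
- by rewrite -natrM mulnb andbb.
- by rewrite -natrM mulnb andbb.
- by rewrite !addr0 !mulr1.
Qed.

Fact boalch_one_neq0 : boalch_one != 0.
Proof.
apply/eqP; rewrite -boalch_pi1 => e10.
have /boalch_eqP : \pi_boalch 1 = \pi_boalch 0 by rewrite [RHS]raddf0.
rewrite subr0 => /asboolP span1.
have rep_rel x y : boalch_rel (rep \o fgen) x y -> x = y.
  by rewrite (_ : rep \o fgen = chi); [exact: chi_rel | exact/funext/rep_gen].
have := boalch_span_morph rep_rel span1.
by rewrite rmorph1 => /eqP; rewrite oner_eq0.
Qed.

HB.instance Definition _ := GRing.Zmodule_isNzRing.Build boalch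
  boalch_mulA boalch_mul1 boalch_mulr1 boalch_mulDl boalch_mulDr boalch_one_neq0.

Fact boalch_scaleA a b x :
  boalch_scale a (boalch_scale b x) = boalch_scale (a * b) x.
Proof.
by elim/quotW: x => x; rewrite -(boalch_piZ b x) -!boalch_piZ scalerA.
Qed.

Fact boalch_scale1 : left_id 1 boalch_scale.
Proof. by elim/quotW=> x; rewrite -boalch_piZ scale1r. Qed.

Fact boalch_scaleDr : right_distributive boalch_scale +%R.
Proof.
move=> c; elim/quotW=> x; elim/quotW=> y.
by rewrite -boalch_piD -(boalch_piZ c x) -(boalch_piZ c y) -boalch_piZ scalerDr boalch_piD.
Qed.

Fact boalch_scaleDl x : {morph boalch_scale^~ x : a b / a + b}.
Proof.
elim/quotW: x => x a b.
by rewrite -(boalch_piZ a x) -(boalch_piZ b x) -boalch_piZ scalerDl boalch_piD.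
Qed.

HB.instance Definition _ := GRing.Zmodule_isLmodule.Build k boalch
  boalch_scaleA boalch_scale1 boalch_scaleDr boalch_scaleDl.

Fact boalch_scalerAl (c : k) (x y : boalch) : c *: (x * y) = (c *: x) * y.
Proof.
rewrite -[LHS]/(boalch_scale c (boalch_mul x y)).
rewrite -[RHS]/(boalch_mul (boalch_scale c x) y).
elim/quotW: x => x; elim/quotW: y => y.
by rewrite -(boalch_piM x y) -!boalch_piZ -boalch_piM scalerAl.
Qed.

HB.instance Definition _ :=
  GRing.Lmodule_isLalgebra.Build k boalch boalch_scalerAl.

Fact boalch_scalerAr (c : k) (x y : boalch) : c *: (x * y) = x * (c *: y).
Proof.
rewrite -[LHS]/(boalch_scale c (boalch_mul x y)).
rewrite -[RHS]/(boalch_mul x (boalch_scale c y)).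
elim/quotW: x => x; elim/quotW: y => y.
by rewrite -(boalch_piM x y) -!boalch_piZ -boalch_piM freealg_scalerAr.
Qed.

HB.instance Definition _ :=
  GRing.Lalgebra_isAlgebra.Build k boalch boalch_scalerAr.

Definition bgen : gen -> boalch :=
  locked_with boalch_key (fun x => \pi_boalch (fgen x)).

Fact bgenE x : bgen x = \pi_boalch (fgen x).
Proof. by rewrite /bgen; case: boalch_key. Qed.

Definition boalch_pi : freealg -> boalch := \pi_boalch.

Fact boalch_pi_zmod_morphism : zmod_morphism boalch_pi.
Proof. exact: raddfB. Qed.

HB.instance Definition _ :=
  GRing.isZmodMorphism.Build freealg boalch boalch_pi boalch_pi_zmod_morphism.

Fact boalch_pi_monoid_morphism : monoid_morphism boalch_pi.
Proof. by split; [exact: boalch_pi1 | exact: boalch_piM]. Qed.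

HB.instance Definition _ := GRing.isMonoidMorphism.Build freealg boalch
  boalch_pi boalch_pi_monoid_morphism.

Lemma bgen_rel x y : boalch_rel bgen x y -> x = y.
Proof.
have -> : bgen = boalch_pi \o fgen by apply/funext => g; rewrite bgenE.
move=> /(boalch_rel_lift (f := boalch_pi))[p [q [pq -> ->]]].
by apply/boalch_eqP/asboolP/span_rel.
Qed.

Definition be i : boalch := bgen (Gen_e i).
Definition bv a : boalch := bgen (Gen_v a).
Definition bw a : boalch := bgen (Gen_w a).
Definition bg i : boalch := bgen (Gen_g i).
Definition bginv i : boalch := bgen (Gen_ginv i).

End Boalch.

Section Bracket.
Variable k : fieldType.

Local Notation A := (boalch k).
Local Notation "a # b" := (@tens k A A a b) (at level 39, no associativity).
Local Notation h := (2^-1 : k).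

Definition boalch_bracket_values (br : A -> A -> tensor A A) : Prop :=
  let e1 : A := be k i1 in let e2 : A := be k i2 in let e3 : A := be k i3 in
  let v12 : A := bv k a12 in let v13 : A := bv k a13 in
  let v21 : A := bv k a21 in let v23 : A := bv k a23 in
  let v31 : A := bv k a31 in let v32 : A := bv k a32 in
  [/\ forall a : arrow, br (bv k a) (bv k a) = 0,
     [/\ br v12 v13 = h *: (v12 # v13),
         br v12 v32 = h *: (v32 # v12),
         br v21 v31 = - h *: (v31 # v21)
       & br v21 v23 = - h *: (v21 # v23)],
     [/\ br v13 v23 = h *: (v23 # v13),
         br v13 v32 = - h *: (e3 # (v13 * v32)),
         br v31 v23 = h *: ((v23 * v31) # e3)
       & br v31 v32 = - h *: (v31 # v32)],
     [/\ br v12 v21 = - (e2 # e1)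
           - h *: (e2 # (v12 * v21) + (v21 * v12) # e1),
         br v12 v31 = - h *: ((v31 * v12) # e1) - v32 # e1,
         br v12 v23 = - h *: (e2 # (v12 * v23)) + e2 # v13
       & br v21 v13 = h *: (e1 # (v21 * v13)) + e1 # v23]
   & [/\ br v21 v32 = h *: ((v32 * v21) # e2) - v31 # e2,
         br v13 v31 = - (e3 # e1) - (v32 * v23) # e1
           - h *: (e3 # (v13 * v31) + (v31 * v13) # e1)
       & br v23 v32 = - (e3 # e2)
           - h *: (e3 # (v23 * v32) + (v32 * v23) # e2)]].

End Bracket.

(* Main.v *)
Require Import Defs.
From HB Require Import structures.
From mathcomp Require Import all_boot all_algebra.
From mathcomp Require Import boolp.
From mathcomp.multinomials Require Import monalg.

Set Implicit Arguments.
Unset Strict Implicit.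
Unset Printing Implicit Defensive.

Import GRing.Theory.

Local Open Scope ring_scope.
Local Open Scope quotient_scope.

(** Let [LU] be the left-hand side of the matrix relation and [C] its inverse.
    Reading the relation entry by entry along [1 = e_1 + e_2 + e_3] expresses all
    generators through the [e_i], the [v_ij] and the inverses of the [gamma_i]:
    [gamma_3 = e_3 + v_31 v_13 + v_32 v_23] is the last diagonal entry of [LU],
    [gamma_1^-1] is the first diagonal entry of [C], again a polynomial in the
    [v_ij], and [gamma_2] is the Schur complement of [gamma_3] in the lower right
    block of [LU].  Conversely, inverting only [gamma_3] and [gamma_1^-1] makes the
    whole factorization exist ([complete_boalch]), so the algebra is the
    localization of a path algebra at two elements.

    Hence a derivation into a bimodule is determined by its values on the [v_ij],
    which can be prescribed freely between the right idempotents ([der_ext] and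
    [der_exists]; the latter applies the universal property to a square-zero
    extension, where inverses lift).  A double bracket is a derivation for the
    outer bimodule structure of [A (x) A] in its second argument and, by
    antisymmetry, for the inner structure in its first one.  Applying [der_exists]
    once for each structure constructs the bracket, and [der_ext] gives its
    antisymmetry and its uniqueness.

    The difference of the two sides of the quasi-Poisson identity is a derivation
    in its last argument ([triple_der], [qP_der]) and is equivariant under cyclic
    permutations, so it vanishes as soon as it vanishes on the arrows.  For fixed
    [Phi_s] both sides of the moment map condition are derivations, so arrows
    suffice there as well.  For [gamma_3] and [gamma_1^-1] this is an identity in the
    path algebra, and the condition passes to inverses up to sign
    ([moment_inv]); for [gamma_2] it is an identity in the path algebra with
    [gamma_3^-1] adjoined.

    What remains are finitely many identities between integral combinations of
    tensors of paths.  They are decided by computation: words in the generators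
    have a normal form, and a combination is zero when the coefficients of each
    normal form add up to zero.  Since the brackets of arrows are halves of
    integral combinations, integer coefficients are enough. *)

(** * Integral linear combinations *)

Definition lincomb (K : Type) (V : zmodType) (f : K -> V) (l : seq (int * K)) :=
  \sum_(p <- l) f p.2 *~ p.1.

Definition lc_opp (K : Type) (l : seq (int * K)) := [seq (- p.1, p.2) | p <- l].

Fixpoint coef (K : eqType) (x : K) (l : seq (int * K)) : int :=
  if l is p :: l' then (if p.2 == x then p.1 + coef x l' else coef x l') else 0.

(** A sufficient criterion for a combination to vanish under every evaluation of
    its symbols. *)
Definition balanced (K : eqType) (l : seq (int * K)) : bool :=
  all (fun p => coef p.2 l == 0) l.

Section LinComb.
Variables (K : Type) (V : zmodType).
Implicit Types (f : K -> V) (l : seq (int * K)).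

Lemma lincomb_nil f : lincomb f [::] = 0.
Proof. exact: big_nil. Qed.

Lemma lincomb_cons f p l : lincomb f (p :: l) = f p.2 *~ p.1 + lincomb f l.
Proof. exact: big_cons. Qed.

Lemma lincomb_cat f l l' : lincomb f (l ++ l') = lincomb f l + lincomb f l'.
Proof. exact: big_cat. Qed.

Lemma lincomb_opp f l : lincomb f (lc_opp l) = - lincomb f l.
Proof.
by rewrite /lincomb big_map -sumrN; apply: eq_bigr => p _; rewrite mulrNz.
Qed.

Lemma lincomb_map (K' : Type) (h : K -> K') (f : K' -> V) l :
  lincomb f [seq (p.1, h p.2) | p <- l] = lincomb (f \o h) l.
Proof. by rewrite /lincomb big_map. Qed.

Lemma lincomb_scale f c l :
  lincomb f [seq (c * p.1, p.2) | p <- l] = lincomb f l *~ c.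
Proof.
rewrite /lincomb big_map /= [RHS]mulrz_suml; apply: eq_bigr => p _.
by rewrite mulrC mulrzA.
Qed.

Lemma eq_lincomb f f' l : f =1 f' -> lincomb f l = lincomb f' l.
Proof. by move=> ff'; apply: eq_bigr => p _; rewrite ff'. Qed.

Lemma raddf_lincomb (W : zmodType) (F : V -> W) f l :
  F 0 = 0 -> {morph F : x y / x + y} -> F (lincomb f l) = lincomb (F \o f) l.
Proof.
move=> F0 FD.
have FN x : F (- x) = - F x.
  by apply: (addrI (F x)); rewrite -FD !subrr.
have FMn x n : F (x *+ n) = F x *+ n.
  by elim: n => // n IH; rewrite !mulrS FD IH.
rewrite /lincomb (big_morph F FD F0); apply: eq_bigr => -[[] n x] _ //=.
  exact: FMn.
by rewrite NegzE !mulrNz FN; congr (- _); exact: FMn.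
Qed.

End LinComb.

Lemma lincomb_balanced (K : eqType) (V : zmodType) (f : K -> V) l :
  balanced l -> lincomb f l = 0.
Proof.
move=> bal.
have coefE x : coef x l = \sum_(p <- l | p.2 == x) p.1.
  elim: l {bal} => [|p l IH] /=; first by rewrite big_nil.
  by rewrite big_cons IH.
have -> : lincomb f l = \sum_(x <- undup (map snd l)) f x *~ coef x l.
  transitivity (\sum_(p <- l) \sum_(x <- undup (map snd l) | x == p.2)
                  f x *~ p.1).
    rewrite /lincomb big_seq [RHS]big_seq; apply: eq_bigr => p pl.
    by rewrite -big_filter filter_pred1_uniq ?undup_uniq ?big_seq1 // mem_undup map_f.
  rewrite (exchange_big_dep predT) //=; apply: eq_bigr => x _.
  by rewrite coefE mulrz_sumr; apply: eq_bigl => p; rewrite eq_sym.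
rewrite big1_seq // => x /andP[_]; rewrite mem_undup => /mapP[p pl ->].
by rewrite (eqP (allP bal p pl)).
Qed.

(** * Words in the generators *)

Definition is_e (x : gen) := if x is Gen_e _ then true else false.

Definition src (x : gen) : 'I_3 :=
  match x with
  | Gen_e i | Gen_g i | Gen_ginv i => i
  | Gen_v a | Gen_w a => (val a).1
  end.

Definition tgt (x : gen) : 'I_3 :=
  match x with
  | Gen_e i | Gen_g i | Gen_ginv i => i
  | Gen_v a | Gen_w a => (val a).2
  end.

Notation word := (seq gen).

Definition composable (w : word) := sorted (fun x y => tgt x == src y) w.

(** A composable word is determined by the vertex where it starts and by its
    letters other than idempotents.  Keeping the starting vertex as a leading [e_i]
    makes the paths of length zero no exception. *)
Definition nf (w : word) : word :=
  if w is x :: _ then Gen_e (src x) :: [seq y <- w | ~~ is_e y] else [::].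

Definition poly1 := seq (int * word).

Definition nf1 (l : poly1) : poly1 :=
  [seq (p.1, nf p.2) | p <- l & composable p.2].

Definition mul1 (l l' : poly1) : poly1 :=
  [seq (p.1 * p'.1, p.2 ++ p'.2) | p <- l, p' <- l'].

Definition mono (w : word) : poly1 := [:: (1, w)].

(** What the normal form of words needs: orthogonal idempotents and generators
    that sit between two of them.  Families that satisfy the remaining relations
    only in part are of this kind too, which is used to construct morphisms. *)
Record path_family (R : nzRingType) (g : gen -> R) : Prop := PathFamily {
  path_e : forall i j, g (Gen_e i) * g (Gen_e j) = if i == j then g (Gen_e i) else 0;
  path_src : forall x, g (Gen_e (src x)) * g x = g x;
  path_tgt : forall x, g x * g (Gen_e (tgt x)) = g x }.

Definition evw (R : nzRingType) (g : gen -> R) (w : word) : R := \prod_(x <- w) g x.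

Section Words.
Variables (R : nzRingType) (g : gen -> R).

Notation ev := (evw g).
Notation ev1 := (lincomb ev).

Lemma evw_nil : ev [::] = 1. Proof. exact: big_nil. Qed.
Lemma evw_cons x w : ev (x :: w) = g x * ev w. Proof. exact: big_cons. Qed.
Lemma evw_cat u w : ev (u ++ w) = ev u * ev w. Proof. exact: big_cat. Qed.
Lemma evw1 x : ev [:: x] = g x. Proof. exact: big_seq1. Qed.

Lemma ev_mul1 l l' : ev1 (mul1 l l') = ev1 l * ev1 l'.
Proof.
elim: l => [|[c w] l IH]; first by rewrite /lincomb !big_nil mul0r.
rewrite /mul1 /= lincomb_cat -/(mul1 l l') IH lincomb_cons mulrDl; congr (_ + _).
elim: l' {IH} => [|[d u] l' IH]; first by rewrite !lincomb_nil mulr0.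
rewrite /= !lincomb_cons IH mulrDr; congr (_ + _) => /=.
by rewrite evw_cat mulrzA mulrzAl mulrzAr mulrzAC.
Qed.

Hypothesis gP : path_family g.

Lemma g_mul0 x y : tgt x != src y -> g x * g y = 0.
Proof.
move=> /negbTE xy; rewrite -(path_tgt gP x) -(path_src gP y) -mulrA [_ * (_ * g y)]mulrA.
by rewrite path_e // xy mul0r mulr0.
Qed.

Lemma evw_composable w : ~~ composable w -> ev w = 0.
Proof.
elim: w => // x [//|y w] IH; rewrite /composable /= negb_and => /orP[xy|/IH yw].
  by rewrite !evw_cons mulrA g_mul0 ?mul0r.
by rewrite evw_cons yw mulr0.
Qed.

(** An idempotent between composable letters is absorbed by its neighbours. *)
Lemma evw_nf w : composable w -> ev (nf w) = ev w.
Proof.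
have key x s : ev (Gen_e (src x) :: (if ~~ is_e x then x :: s else s)) = g x * ev s.
  have [|_] := boolP (is_e x); last by rewrite !evw_cons mulrA path_src.
  by case: x => // i _; rewrite evw_cons.
case: w => // x w; elim: w x => [|y w IH] x; first by rewrite key evw_cons.
case/andP=> /eqP xy /IH {}IH; rewrite [LHS]key evw_cons -{}IH evw_cons mulrA -xy.
by rewrite path_tgt.
Qed.

Lemma ev_nf1 l : ev1 (nf1 l) = ev1 l.
Proof.
elim: l => // -[c w] l IH; rewrite /nf1 /=; case: ifP => /= cw; rewrite !lincomb_cons.
  by rewrite -/(nf1 l) IH /= evw_nf.
by rewrite -/(nf1 l) IH evw_composable ?cw // mul0rz add0r.
Qed.

Lemma ev_mono w : ev1 (mono w) = ev w.
Proof. by rewrite /mono lincomb_cons lincomb_nil addr0. Qed.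

Lemma ev1_eq l l' : balanced (nf1 (l ++ lc_opp l')) -> ev1 l = ev1 l'.
Proof.
move=> /(lincomb_balanced (evw g)); rewrite ev_nf1 lincomb_cat lincomb_opp.
by move/eqP; rewrite subr_eq0 => /eqP.
Qed.

End Words.

(** * A decision procedure for identities in path algebras *)

(** Reified ring expressions in the generators; [path_ring] decides an equation
    between two of them by comparing normal forms of words. *)
Inductive rexp := RX of gen | R0 | R1 | RD of rexp & rexp | RN of rexp | RM of rexp & rexp.

Fixpoint rexp_eval (R : nzRingType) (g : gen -> R) (t : rexp) : R :=
  match t with
  | RX x => g x
  | R0 => 0
  | R1 => 1
  | RD a b => rexp_eval g a + rexp_eval g b
  | RN a => - rexp_eval g a
  | RM a b => rexp_eval g a * rexp_eval g b
  end.

Fixpoint rnorm (t : rexp) : poly1 :=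
  match t with
  | RX x => mono [:: x]
  | R0 => [::]
  | R1 => mono [::]
  | RD a b => rnorm a ++ rnorm b
  | RN a => lc_opp (rnorm a)
  | RM a b => mul1 (rnorm a) (rnorm b)
  end.

Lemma rnormE (R : nzRingType) (g : gen -> R) t :
  lincomb (evw g) (rnorm t) = rexp_eval g t.
Proof.
elim: t => [x||| a IHa b IHb| a IHa| a IHa b IHb] /=.
- by rewrite ev_mono evw1.
- exact: lincomb_nil.
- by rewrite ev_mono evw_nil.
- by rewrite lincomb_cat IHa IHb.
- by rewrite lincomb_opp IHa.
- by rewrite ev_mul1 IHa IHb.
Qed.

Lemma path_eq (R : nzRingType) (g : gen -> R) (gP : path_family g) s t :
  balanced (nf1 (rnorm s ++ lc_opp (rnorm t))) -> rexp_eval g s = rexp_eval g t.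
Proof. by move=> /(ev1_eq gP); rewrite !rnormE. Qed.

Ltac reify g t :=
  lazymatch t with
  | g ?x => constr:(RX x)
  | (?a + ?b)%R => let s := reify g a in let t := reify g b in constr:(RD s t)
  | (?a * ?b)%R => let s := reify g a in let t := reify g b in constr:(RM s t)
  | (- ?a)%R => let s := reify g a in constr:(RN s)
  | (0)%R => constr:(R0)
  | (1)%R => constr:(R1)
  end.

Ltac path_ring gP :=
  lazymatch type of gP with path_family ?g =>
  lazymatch goal with |- ?x = ?y =>
    let s := reify g x in let t := reify g y in
    apply: (@path_eq _ g gP s t); vm_compute; reflexivity
  end end.

(** * The defining relations, entry by entry *)

Notation Ge := Gen_e.
Notation Gv := Gen_v.
Notation Gw := Gen_w.
Notation Gg := Gen_g.
Notation Gi := Gen_ginv.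

Lemma ord3P (P : 'I_3 -> Prop) : P i1 -> P i2 -> P i3 -> forall i, P i.
Proof.
move=> P1 P2 P3 [[|[|[|//]]] ltn3].
- by rewrite (_ : Ordinal _ = i1) //; exact: val_inj.
- by rewrite (_ : Ordinal _ = i2) //; exact: val_inj.
- by rewrite (_ : Ordinal _ = i3) //; exact: val_inj.
Qed.

Lemma arrowP (P : arrow -> Prop) :
  P a12 -> P a13 -> P a21 -> P a23 -> P a31 -> P a32 -> forall a, P a.
Proof.
move=> P12 P13 P21 P23 P31 P32 [[i j] ij].
have ext a : P a -> val a = (i, j) -> P (exist _ (i, j) ij).
  by move=> Pa eq_a; rewrite (_ : exist _ _ _ = a) //; exact: val_inj.
move: i j ij ext; apply: ord3P; apply: ord3P => ij ext //.
- exact: (ext a12).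
- exact: (ext a13).
- exact: (ext a21).
- exact: (ext a23).
- exact: (ext a31).
- exact: (ext a32).
Qed.

Section Entries.
Variables (R : nzRingType) (g : gen -> R).

Lemma eq_entries x y : \sum_i g (Ge i) = 1 ->
  (forall i j, g (Ge i) * x * g (Ge j) = g (Ge i) * y * g (Ge j)) -> x = y.
Proof.
move=> sum_e xy.
have dec z : z = \sum_i \sum_j g (Ge i) * z * g (Ge j).
  rewrite -[LHS]mul1r -sum_e mulr_suml; apply: eq_bigr => i _.
  by rewrite -mulr_sumr sum_e mulr1.
by rewrite [x]dec [y]dec; apply: eq_bigr => i _; apply: eq_bigr => j _.
Qed.

Hypothesis gP : path_family g.

Notation E i := (g (Ge i)).
Notation V a := (g (Gv a)).
Notation W a := (g (Gw a)).
Notation G i := (g (Gg i)).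


Local Notation LU := ((1 + V a21 + V a31 + V a32) * (1 + V a12 + V a13 + V a23)).
Local Notation UDL := ((1 + W a12 + W a13 + W a23) * (G i1 + G i2 + G i3)
      * (1 + W a21 + W a31 + W a32)).

Lemma LU_entries :
  [/\ [/\ E i1 * LU * E i1 = E i1, E i1 * LU * E i2 = V a12
        & E i1 * LU * E i3 = V a13],
      [/\ E i2 * LU * E i1 = V a21,
          E i2 * LU * E i2 = E i2 + V a21 * V a12
        & E i2 * LU * E i3 = V a23 + V a21 * V a13]
    & [/\ E i3 * LU * E i1 = V a31,
          E i3 * LU * E i2 = V a32 + V a31 * V a12
        & E i3 * LU * E i3 = E i3 + V a31 * V a13 + V a32 * V a23]].
Proof. by split; split; path_ring gP. Qed.

Lemma UDL_entries :
  [/\ [/\ E i1 * UDL * E i1 = G i1 + W a12 * G i2 * W a21 + W a13 * G i3 * W a31,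
          E i1 * UDL * E i2 = W a12 * G i2 + W a13 * G i3 * W a32
        & E i1 * UDL * E i3 = W a13 * G i3],
      [/\ E i2 * UDL * E i1 = G i2 * W a21 + W a23 * G i3 * W a31,
          E i2 * UDL * E i2 = G i2 + W a23 * G i3 * W a32
        & E i2 * UDL * E i3 = W a23 * G i3]
    & [/\ E i3 * UDL * E i1 = G i3 * W a31,
          E i3 * UDL * E i2 = G i3 * W a32
        & E i3 * UDL * E i3 = G i3]].
Proof. by split; split; path_ring gP. Qed.

(** The main relation, as the nine corners of [LU = (1 + w) gamma (1 + w')]. *)
Definition main_entries : Prop :=
  [/\ [/\ E i1 = G i1 + W a12 * G i2 * W a21 + W a13 * G i3 * W a31,
          V a12 = W a12 * G i2 + W a13 * G i3 * W a32
        & V a13 = W a13 * G i3],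
      [/\ V a21 = G i2 * W a21 + W a23 * G i3 * W a31,
          E i2 + V a21 * V a12 = G i2 + W a23 * G i3 * W a32
        & V a23 + V a21 * V a13 = W a23 * G i3]
    & [/\ V a31 = G i3 * W a31,
          V a32 + V a31 * V a12 = G i3 * W a32
        & E i3 + V a31 * V a13 + V a32 * V a23 = G i3]].

Lemma main_entriesP : \sum_i E i = 1 -> LU = UDL <-> main_entries.
Proof.
have [[l11 l12 l13] [l21 l22 l23] [l31 l32 l33]] := LU_entries.
have [[u11 u12 u13] [u21 u22 u23] [u31 u32 u33]] := UDL_entries.
move=> sum_e; split=> [eqLU|].
  have tr i j a b : E i * LU * E j = a -> E i * UDL * E j = b -> a = b.
    by move=> <- <-; rewrite eqLU.
  split; split; [exact: tr l11 u11 | exact: tr l12 u12 | exact: tr l13 u13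
    | exact: tr l21 u21 | exact: tr l22 u22 | exact: tr l23 u23
    | exact: tr l31 u31 | exact: tr l32 u32 | exact: tr l33 u33].
case=> [[m11 m12 m13] [m21 m22 m23] [m31 m32 m33]].
apply: eq_entries => //; apply: ord3P; apply: ord3P.
- by rewrite l11 u11.
- by rewrite l12 u12.
- by rewrite l13 u13.
- by rewrite l21 u21.
- by rewrite l22 u22.
- by rewrite l23 u23.
- by rewrite l31 u31.
- by rewrite l32 u32.
- by rewrite l33 u33.
Qed.

End Entries.

Section RelFamily.
Variables (R : nzRingType) (g : gen -> R).

Notation E i := (g (Ge i)).
Notation V a := (g (Gv a)).
Notation W a := (g (Gw a)).
Notation G i := (g (Gg i)).
Notation GI i := (g (Gi i)).

Definition boalch_family : Prop := forall x y, boalch_rel g x y -> x = y.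

Lemma sum_ord3 (F : 'I_3 -> R) : \sum_i F i = F i1 + F i2 + F i3.
Proof.
rewrite !big_ord_recl big_ord0 addr0 addrA; congr (F _ + F _ + F _); exact: val_inj.
Qed.

Lemma boalch_familyP : boalch_family <->
  [/\ path_family g, \sum_i E i = 1,
      forall i, G i * GI i = E i, forall i, GI i * G i = E i
    & main_entries g].
Proof.
split=> [gP|[gP sum_e gV Vg me] x y].
  have sum_e : \sum_i E i = 1 by rewrite sum_ord3 -(gP _ _ (brel_unit g)).
  have eE i j := gP _ _ (brel_e g i j).
  have pg : path_family g.
    have ends x : g (Ge (src x)) * g x * g (Ge (tgt x)) = g x.
      case: x => [i|[[i j] ij]|[[i j] ij]|i|i] /=.
      - by rewrite !eE eqxx eE eqxx.
      - by rewrite -(gP _ _ (brel_v g ij)).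
      - by rewrite -(gP _ _ (brel_w g ij)).
      - by rewrite -(gP _ _ (brel_g g i)).
      - by rewrite -(gP _ _ (brel_ginv g i)).
    split=> // x.
    - by rewrite -(ends x) !mulrA eE eqxx.
    - by rewrite -(ends x) -!mulrA eE eqxx.
  split=> // [i|i|].
  - exact: gP (brel_gV g i).
  - exact: gP (brel_Vg g i).
  - exact/(main_entriesP pg sum_e)/(gP _ _ (brel_main g)).
case=> [|i j|i j ij|i j ij|i|i|i|i|].
- by rewrite -sum_e sum_ord3.
- exact: path_e.
- have s := path_src gP (Gv (arr ij)); have t := path_tgt gP (Gv (arr ij)).
  by rewrite [E i * _]s [_ * E j]t.
- have s := path_src gP (Gw (arr ij)); have t := path_tgt gP (Gw (arr ij)).
  by rewrite [E i * _]s [_ * E j]t.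
- have s := path_src gP (Gg i); have t := path_tgt gP (Gg i).
  by rewrite [E i * _]s [_ * E i]t.
- have s := path_src gP (Gi i); have t := path_tgt gP (Gi i).
  by rewrite [E i * _]s [_ * E i]t.
- exact: gV.
- exact: Vg.
- exact/(main_entriesP gP sum_e).
Qed.

Hypothesis gP : boalch_family.

Lemma boalch_path : path_family g.
Proof. by case/boalch_familyP: gP. Qed.

(** The factorization of [LU] is solved from the last row and column backwards,
    as in Gaussian elimination. *)
Lemma gamma3E : G i3 = E i3 + V a31 * V a13 + V a32 * V a23.
Proof. by case/boalch_familyP: gP => _ _ _ _ [_ _ [_ _ ->]]. Qed.

Lemma w13E : W a13 = V a13 * GI i3.
Proof.
case/boalch_familyP: gP => pg _ gV _ [[_ _ ->] _ _].
by rewrite -mulrA gV (path_tgt pg (Gw a13)).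
Qed.

Lemma w23E : W a23 = (V a23 + V a21 * V a13) * GI i3.
Proof.
case/boalch_familyP: gP => pg _ gV _ [_ [_ _ ->] _].
by rewrite -mulrA gV (path_tgt pg (Gw a23)).
Qed.

Lemma w31E : W a31 = GI i3 * V a31.
Proof.
case/boalch_familyP: gP => pg _ _ Vg [_ _ [-> _ _]].
by rewrite mulrA Vg (path_src pg (Gw a31)).
Qed.

Lemma w32E : W a32 = GI i3 * (V a32 + V a31 * V a12).
Proof.
case/boalch_familyP: gP => pg _ _ Vg [_ _ [_ -> _]].
by rewrite mulrA Vg (path_src pg (Gw a32)).
Qed.

Lemma gamma2E :
  G i2 = E i2 + V a21 * V a12 - (V a23 + V a21 * V a13) * W a32.
Proof.
case/boalch_familyP: gP => pg _ _ _ [_ [_ -> ->] _].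
by rewrite addrK.
Qed.

Lemma w12E : W a12 = (V a12 - V a13 * W a32) * GI i2.
Proof.
case/boalch_familyP: gP => pg _ gV _ [[_ -> ->] _ _].
by rewrite addrK -mulrA gV (path_tgt pg (Gw a12)).
Qed.

Lemma w21E : W a21 = GI i2 * (V a21 - W a23 * V a31).
Proof.
case/boalch_familyP: gP => pg _ _ Vg [_ [-> _ _] [-> _ _]].
by rewrite mulrA addrK mulrA Vg (path_src pg (Gw a21)).
Qed.

Lemma gamma1E :
  G i1 = E i1 - W a12 * G i2 * W a21 - W a13 * G i3 * W a31.
Proof.
by case/boalch_familyP: gP => pg _ _ _ [[-> _ _] _ _]; rewrite addrAC addrK addrK.
Qed.

(** Below, [r] is the first row of [(LU)^-1], a polynomial in the [v_ij], and [u] is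
    the first column of the inverse of the lower unitriangular factor.  The other
    two factors form an upper triangular matrix, so [LU u = gamma_1], and
    therefore [r gamma_1 = r LU u = e_1 u = e_1]. *)
Lemma ginv1E :
  GI i1 = E i1 + V a12 * V a21 + (V a13 - V a12 * V a23) * (V a31 - V a32 * V a21).
Proof.
case/boalch_familyP: gP => pg _ gV _ _.
set c := RHS.
pose r := (E i1 - V a12 - V a13 + V a12 * V a23)
          * (1 - V a21 - V a31 - V a32 + V a32 * V a21).
pose u := E i1 - W a21 - W a31 + W a32 * W a21.
have rLU : r * ((1 + V a21 + V a31 + V a32) * (1 + V a12 + V a13 + V a23)) = E i1.
  by rewrite /r; path_ring pg.
have UDLu : (1 + W a12 + W a13 + W a23) * (G i1 + G i2 + G i3)
      * (1 + W a21 + W a31 + W a32) * u = G i1 by rewrite /u; path_ring pg.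
have cG : c * G i1 = E i1.
  transitivity (r * G i1); first by rewrite /c /r; path_ring pg.
  rewrite -UDLu -(gP (brel_main g)) mulrA rLU /u; path_ring pg.
transitivity (c * G i1 * GI i1); first by rewrite cG (path_src pg (Gi i1)).
by rewrite -mulrA gV /c; path_ring pg.
Qed.

End RelFamily.

Section BoalchInduction.
Variable k : fieldType.
Implicit Types (P : boalch k -> Prop) (x y : boalch k).

Lemma bgen_family : boalch_family (bgen k).
Proof. by move=> x y; exact: bgen_rel. Qed.

Lemma bgen_path : path_family (bgen k).
Proof. exact: boalch_path bgen_family. Qed.

Lemma bgen_ind P :
  (forall x y, P x -> P y -> P (x + y)) -> (forall c x, P x -> P (c *: x)) ->
  (forall x y, P x -> P y -> P (x * y)) -> (forall s, P (bgen k s)) ->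
  forall x, P x.
Proof.
move=> PD PZ PM Pg x.
have P1 : P 1.
  case/boalch_familyP: bgen_family => _ <- _ _ _; rewrite sum_ord3.
  by apply: (PD) => //; exact: (PD).
have P0 : P 0 by rewrite -(scale0r 1); exact: (PZ).
have Pmono (m : {fmonom gen}) : P (@boalch_pi k << m >>).
  case: m => s; elim: s => [|y s IH].
    rewrite (_ : FMonom [::] = mone); last by apply/eqP; rewrite fmP fm1.
    by rewrite rmorph1.
  rewrite (_ : << FMonom (y :: s) >> = fgen k y * << FMonom s >>).
    by rewrite rmorphM; apply: (PM) => //; have := Pg y; rewrite bgenE.
  by rewrite fgenE malgM_def fgmulUU mulr1; congr << _ >>; apply/eqP; rewrite fmP fmM fmuE.
rewrite -[x]reprK -[\pi_(boalch k) _]/(@boalch_pi k (repr x)) [repr x]monalgE.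
rewrite rmorph_sum; elim/big_ind: _ => // m _.
rewrite (_ : << _ *g m >> = (repr x)@_m *: << m >>); last first.
  by rewrite -mul_malgC malgM_def fgmulUU mul1m mulr1.
rewrite [X in P X](boalch_piZ _ (<< m >> : {malg k[{fmonom gen}]})).
exact: (PZ _ _ (Pmono m)).
Qed.

(** The algebra is generated by the arrows and by the inverses of the [gamma_i],
    where each [gamma_i] is obtained before its inverse is needed. *)
Lemma boalch_ind P :
  (forall x y, P x -> P y -> P (x + y)) -> (forall c x, P x -> P (c *: x)) ->
  (forall x y, P x -> P y -> P (x * y)) ->
  (forall i, P (be k i)) -> (forall a, P (bv k a)) ->
  (forall i, P (bg k i) -> P (bginv k i)) ->
  forall x, P x.
Proof.
move=> PD PZ PM Pe Pv Pi.
have PB x y : P x -> P y -> P (x - y).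
  by move=> Px Py; apply: (PD) => //; rewrite -scaleN1r; exact: (PZ).
have bP := bgen_family.
have {}Pe i : P (bgen k (Ge i)) by exact: Pe.
have {}Pv a : P (bgen k (Gv a)) by exact: Pv.
have PDD x y z : P x -> P y -> P z -> P (x + y + z).
  by move=> *; apply: (PD) => //; exact: (PD).
have Pg3 : P (bg k i3) by rewrite [bg _ _](gamma3E bP); apply: PDD => //; exact: (PM).
have Pi3 := Pi _ Pg3.
have Pw13 : P (bw k a13) by rewrite [bw _ _](w13E bP); exact: (PM).
have Pw23 : P (bw k a23).
  by rewrite [bw _ _](w23E bP); apply: (PM) => //; apply: (PD) => //; exact: (PM).
have Pw31 : P (bw k a31) by rewrite [bw _ _](w31E bP); exact: (PM).
have Pw32 : P (bw k a32).
  by rewrite [bw _ _](w32E bP); apply: (PM) => //; apply: (PD) => //; exact: (PM).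
have Pg2 : P (bg k i2).
  rewrite [bg _ _](gamma2E bP); apply: (PB); first by apply: (PD) => //; exact: (PM).
  by apply: (PM) => //; apply: (PD) => //; exact: (PM).
have Pi2 := Pi _ Pg2.
have Pw12 : P (bw k a12).
  by rewrite [bw _ _](w12E bP); apply: (PM) => //; apply: (PB) => //; exact: (PM).
have Pw21 : P (bw k a21).
  by rewrite [bw _ _](w21E bP); apply: (PM) => //; apply: (PB) => //; exact: (PM).
have Pg1 : P (bg k i1).
  by rewrite [bg _ _](gamma1E bP); do !apply: (PB) => //; apply: (PM) => //; exact: (PM).
have Pi1 := Pi _ Pg1.
apply: bgen_ind => // -[i|a|a|i|i].
- exact: Pe.
- exact: Pv.
- by elim/arrowP: a.
- by elim/ord3P: i.
- by elim/ord3P: i.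
Qed.

End BoalchInduction.

(** * The universal property of the Boalch algebra *)

Section FreeLift.
Variables (k : fieldType) (R : algType k) (g : gen -> R).

Local Notation freealg := {malg k[{fmonom gen}]}.

Let ev (m : {fmonom gen}) : R := evw g m.

Let ev_morph : mmorphism ev.
Proof. by split=> [m m'|]; rewrite /ev ?fm1 ?evw_nil // fmM evw_cat. Qed.

HB.instance Definition _ := isMultiplicative.Build {fmonom gen} R ev ev_morph.

Definition free_lift : freealg -> R := mmap (in_alg R) ev.

HB.instance Definition _ := GRing.Additive.on free_lift.

Let free_lift_comm (x : freealg) m m' : GRing.comm (in_alg R x@_m) (ev m').
Proof. by rewrite /GRing.comm /= mulr_algl mulr_algr. Qed.

Let free_lift_mult : monoid_morphism free_lift.
Proof.
by have [fM f1] := commr_mmap_is_multiplicative free_lift_comm; split.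
Qed.

HB.instance Definition _ :=
  GRing.isMonoidMorphism.Build freealg R free_lift free_lift_mult.

Lemma free_liftZ c x : free_lift (c *: x) = c *: free_lift x.
Proof. by rewrite /free_lift mmapZ /= mulr_algl. Qed.

Lemma free_lift_gen x : free_lift (fgen k x) = g x.
Proof.
by rewrite fgenE [LHS]mmapU /= scale1r mul1r /ev fmuE /= evw1.
Qed.

Hypothesis gP : boalch_family g.

Definition boalch_lift (x : boalch k) : R := free_lift (repr x).

Lemma boalch_lift_pi x : boalch_lift (boalch_pi x) = free_lift x.
Proof.
apply/eqP; rewrite -subr_eq0 -rmorphB; apply/eqP.
apply: (boalch_span_morph (f := free_lift)) => [{}x y xy|].
  apply: gP; rewrite -(_ : free_lift \o fgen k = g) //; exact/funext/free_lift_gen.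
by apply/asboolP/boalch_eqP; rewrite reprK.
Qed.

Lemma boalch_liftP : [/\ forall c x y, boalch_lift (c *: x + y) = c *: boalch_lift x + boalch_lift y,
  forall x y, boalch_lift (x * y) = boalch_lift x * boalch_lift y
  & forall s, boalch_lift (bgen k s) = g s].
Proof.
have piZ c (x : freealg) : c *: boalch_pi x = boalch_pi (c *: x).
  by rewrite [RHS]boalch_piZ.
have piP (x : boalch k) : x = boalch_pi (repr x) by rewrite /boalch_pi reprK.
split=> [c x y|x y|s].
- rewrite (piP x) (piP y) piZ -rmorphD !boalch_lift_pi rmorphD; congr (_ + _).
  exact: free_liftZ.
- by rewrite (piP x) (piP y) -rmorphM !boalch_lift_pi rmorphM.
- by rewrite bgenE -[\pi_(boalch k) _]/(boalch_pi _) boalch_lift_pi free_lift_gen.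
Qed.

End FreeLift.

(** A family for which only [p = gamma_3^-1] and [q = gamma_1] are known besides
    idempotents and arrows extends to all generators.  The [M_ij] are the entries
    of [LU], the [C_ij] those of its inverse. *)
Section Localization.
Variables (R : nzRingType) (g : gen -> R).

Notation E i := (g (Ge i)).
Notation V a := (g (Gv a)).
Notation p := (g (Gi i3)).
Notation q := (g (Gg i1)).

Definition M12 := V a12.
Definition M21 := V a21.
Definition M13 := V a13.
Definition M22 := E i2 + V a21 * V a12.
Definition M23 := V a23 + V a21 * V a13.
Definition M31 := V a31.
Definition M32 := V a32 + V a31 * V a12.
Definition M33 := E i3 + V a31 * V a13 + V a32 * V a23.
Definition C11 := E i1 + V a12 * V a21 + (V a13 - V a12 * V a23) * (V a31 - V a32 * V a21).
Definition C12 := - V a12 + (V a13 - V a12 * V a23) * V a32.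
Definition C21 := - V a21 + V a23 * (V a31 - V a32 * V a21).
Definition C22 := E i2 + V a23 * V a32.

(** [gamma_2] is the Schur complement of [M33], while its inverse is the Schur
    complement of [C11] in the upper left block of the inverse of [LU]; both
    descriptions hold because the Schur complement of [M33] is the inverse of
    that block. *)
Definition complete_family (x : gen) : R :=
  match x with
  | Gen_e i => E i
  | Gen_v a => V a
  | Gen_w a =>
      if a == a12 then - q * C12 else if a == a13 then M13 * p
      else if a == a21 then - C21 * q else if a == a23 then M23 * p
      else if a == a31 then p * M31 else p * M32
  | Gen_g i => if i == i1 then q else if i == i2 then M22 - M23 * p * M32 else M33
  | Gen_ginv i => if i == i1 then C11 else if i == i2 then C22 - C21 * q * C12 else p
  end.

Hypothesis gP : path_family g.
Hypothesis sum_e : \sum_i E i = 1.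
Hypotheses (pM : p * M33 = E i3) (Mp : M33 * p = E i3).
Hypotheses (qC : q * C11 = E i1) (Cq : C11 * q = E i1).

Lemma complete_path : path_family complete_family.
Proof.
split; first exact: path_e gP.
- case=> [i|a|a|i|i].
  + exact: path_src gP (Ge i).
  + exact: path_src gP (Gv a).
  + by elim/arrowP: a => /=; rewrite /M13 /M23 /M31 /M32 /C12 /C21; path_ring gP.
  + by elim/ord3P: i => /=; rewrite /M22 /M23 /M32 /M33; path_ring gP.
  + by elim/ord3P: i => /=; rewrite /C11 /C12 /C21 /C22; path_ring gP.
- case=> [i|a|a|i|i].
  + exact: path_tgt gP (Ge i).
  + exact: path_tgt gP (Gv a).
  + by elim/arrowP: a => /=; rewrite /M13 /M23 /M31 /M32 /C12 /C21; path_ring gP.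
  + by elim/ord3P: i => /=; rewrite /M22 /M23 /M32 /M33; path_ring gP.
  + by elim/ord3P: i => /=; rewrite /C11 /C12 /C21 /C22; path_ring gP.
Qed.

Lemma complete_boalch : boalch_family complete_family.
Proof.
(* In each identity the right-hand side is first written with multiples of these
   four vanishing elements, which turns it into an identity between words. *)
have z1 : E i3 - p * M33 = 0 by rewrite pM subrr.
have z2 : E i3 - M33 * p = 0 by rewrite Mp subrr.
have z3 : E i1 - q * C11 = 0 by rewrite qC subrr.
have z4 : E i1 - C11 * q = 0 by rewrite Cq subrr.
pose C31 := - V a31 + V a32 * V a21.
pose C32 := - V a32.
pose C13 := - V a13 + V a12 * V a23.
pose C23 := - V a23.
apply/boalch_familyP; split; [exact: complete_path | exact: sum_e | | | ].
- apply: ord3P => //=.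
  transitivity (E i2 - M23 * (E i3 - p * M33) * C32
     + M23 * (E i3 - p * M33) * C31 * q * C12
     - (M21 - M23 * p * M31) * (E i1 - C11 * q) * C12).
    by rewrite /M21 /M22 /M23 /M31 /M32 /M33 /C11 /C12 /C21 /C22 /C31 /C32; path_ring gP.
  by rewrite z1 z4 !(mulr0, mul0r, addr0, subr0).
- apply: ord3P => //=.
  transitivity (E i2 - C23 * (E i3 - M33 * p) * M32
     + C21 * q * C13 * (E i3 - M33 * p) * M32
     - C21 * (E i1 - q * C11) * (M12 - M13 * p * M32)).
    by rewrite /M12 /M13 /M22 /M23 /M31 /M32 /M33 /C11 /C12 /C21 /C22 /C13 /C23; path_ring gP.
  by rewrite z2 z3 !(mulr0, mul0r, addr0, subr0).
have w12G2 : - q * C12 * (M22 - M23 * p * M32) = M12 - M13 * p * M32.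
  transitivity (M12 - M13 * p * M32 - (E i1 - q * C11) * (M12 - M13 * p * M32)
     + q * C13 * (E i3 - M33 * p) * M32).
    by rewrite /M12 /M13 /M22 /M23 /M32 /M33 /C11 /C12 /C13; path_ring gP.
  by rewrite z2 z3 !(mulr0, mul0r, addr0, subr0).
have G2w21 : (M22 - M23 * p * M32) * (- C21 * q) = M21 - M23 * p * M31.
  transitivity (M21 - M23 * p * M31 - (M21 - M23 * p * M31) * (E i1 - C11 * q)
     + M23 * (E i3 - p * M33) * C31 * q).
    by rewrite /M21 /M22 /M23 /M31 /M32 /M33 /C11 /C21 /C31; path_ring gP.
  by rewrite z1 z4 !(mulr0, mul0r, addr0, subr0).
split; split; rewrite /= ?w12G2 ?G2w21 -/M12 -/M13 -/M21 -/M22 -/M23 -/M31 -/M32 -/M33;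
  symmetry.
- transitivity (E i1 - (E i1 - M13 * p * M31) * (E i1 - C11 * q)
    - M13 * (E i3 - p * M33) * p * M31 + M13 * (E i3 - p * M33) * C31 * q).
    by rewrite /M12 /M13 /M31 /M32 /M33 /C11 /C21 /C31; path_ring gP.
  by rewrite z1 z4 !(mulr0, mul0r, addr0, subr0).
- transitivity (M12 - M13 * (E i3 - p * M33) * p * M32).
    by rewrite /M12 /M13 /M32 /M33; path_ring gP.
  by rewrite z1 !(mulr0, mul0r, addr0, subr0).
- transitivity (M13 - M13 * (E i3 - p * M33)); last by rewrite z1 mulr0 subr0.
  by rewrite /M13 /M33; path_ring gP.
- transitivity (M21 - M23 * (E i3 - p * M33) * p * M31).
    by rewrite /M21 /M23 /M31 /M33; path_ring gP.
  by rewrite z1 !(mulr0, mul0r, addr0, subr0).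
- transitivity (M22 - M23 * (E i3 - p * M33) * p * M32).
    by rewrite /M22 /M23 /M32 /M33; path_ring gP.
  by rewrite z1 !(mulr0, mul0r, addr0, subr0).
- transitivity (M23 - M23 * (E i3 - p * M33)); last by rewrite z1 mulr0 subr0.
  by rewrite /M23 /M33; path_ring gP.
- transitivity (M31 - (E i3 - M33 * p) * M31); last by rewrite z2 mul0r subr0.
  by rewrite /M31 /M33; path_ring gP.
- transitivity (M32 - (E i3 - M33 * p) * M32); last by rewrite z2 mul0r subr0.
  by rewrite /M32 /M33; path_ring gP.
- by [].
Qed.

End Localization.

(** * Bimodules and derivations *)

Section Bilin.
Variables (k : fieldType) (U V W : lmodType k) (f : U -> V -> W).
Hypothesis fP : bilin f.

Lemma bilinDl u u' v : f (u + u') v = f u v + f u' v.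
Proof. by have := fP.1 v 1 u u'; rewrite !scale1r. Qed.

Lemma bilinDr u v v' : f u (v + v') = f u v + f u v'.
Proof. by have := fP.2 u 1 v v'; rewrite !scale1r. Qed.

Lemma bilin0l v : f 0 v = 0.
Proof. by apply: (addrI (f 0 v)); rewrite -bilinDl !addr0. Qed.

Lemma bilin0r u : f u 0 = 0.
Proof. by apply: (addrI (f u 0)); rewrite -bilinDr !addr0. Qed.

Lemma bilinZl c u v : f (c *: u) v = c *: f u v.
Proof. by have := fP.1 v c u 0; rewrite bilin0l !addr0. Qed.

Lemma bilinZr c u v : f u (c *: v) = c *: f u v.
Proof. by have := fP.2 u c v 0; rewrite bilin0r !addr0. Qed.

Lemma bilinNl u v : f (- u) v = - f u v.
Proof. by rewrite -scaleN1r bilinZl scaleN1r. Qed.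

Lemma bilinNr u v : f u (- v) = - f u v.
Proof. by rewrite -scaleN1r bilinZr scaleN1r. Qed.

End Bilin.

(** Bimodules are records rather than canonical structures because the tensor square
    of an algebra carries two of them, the outer and the inner one. *)
Record bimodule (k : fieldType) (A : algType k) := Bimodule {
  bimod_sort :> lmodType k;
  lact : A -> bimod_sort -> bimod_sort;
  ract : bimod_sort -> A -> bimod_sort;
  lact_bilin : bilin lact;
  ract_bilin : bilin ract;
  lact1 : forall m, lact 1 m = m;
  ract1 : forall m, ract m 1 = m;
  lactM : forall a b m, lact (a * b) m = lact a (lact b m);
  ractM : forall m a b, ract m (a * b) = ract (ract m a) b;
  lact_ract : forall a m b, lact a (ract m b) = ract (lact a m) b }.

(** The square-zero extension of [A] by [M]: algebra sections of the projection
    to [A] are the derivations into [M]. *)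
Definition trivext (k : fieldType) (A : algType k) (M : bimodule A) : Type :=
  (A * M)%type.

Section TrivialExtension.
Variables (k : fieldType) (A : algType k) (M : bimodule A).

HB.instance Definition _ := GRing.Lmodule.copy (trivext M) (A * M)%type.

Implicit Types x y z : trivext M.

Definition trivext_one : trivext M := (1, 0).
Definition trivext_mul x y : trivext M :=
  (x.1 * y.1, lact x.1 y.2 + ract x.2 y.1).

Let lD := bilinDr (lact_bilin M).
Let rD := bilinDl (ract_bilin M).

Fact trivext_mulA : associative trivext_mul.
Proof.
move=> [a m] [b n] [c o]; congr pair; rewrite /= ?mulrA //.
by rewrite lD rD lactM ractM lact_ract addrA.
Qed.

Fact trivext_mul1 : left_id trivext_one trivext_mul.
Proof.
move=> [a m]; rewrite /trivext_mul /= mul1r lact1.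
by rewrite (bilin0l (ract_bilin M)) addr0.
Qed.

Fact trivext_mulr1 : right_id trivext_one trivext_mul.
Proof.
move=> [a m]; rewrite /trivext_mul /= mulr1 ract1.
by rewrite (bilin0r (lact_bilin M)) add0r.
Qed.

Fact trivext_mulDl : left_distributive trivext_mul +%R.
Proof.
move=> [a m] [b n] [c o]; congr pair; rewrite /= ?mulrDl //.
by rewrite (bilinDl (lact_bilin M)) rD addrACA.
Qed.

Fact trivext_mulDr : right_distributive trivext_mul +%R.
Proof.
move=> [a m] [b n] [c o]; congr pair; rewrite /= ?mulrDr //.
by rewrite (bilinDr (ract_bilin M)) lD addrACA.
Qed.

Fact trivext_one_neq0 : trivext_one != 0.
Proof. by apply/eqP => -[/eqP]; rewrite oner_eq0. Qed.

HB.instance Definition _ := GRing.Zmodule_isNzRing.Build (trivext M)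
  trivext_mulA trivext_mul1 trivext_mulr1 trivext_mulDl trivext_mulDr trivext_one_neq0.

Fact trivext_scaleAl (c : k) x y : c *: (x * y) = (c *: x) * y.
Proof.
case: x y => a m [b n]; congr pair; rewrite /= ?scalerAl //.
by rewrite scalerDr (bilinZl (lact_bilin M)) (bilinZl (ract_bilin M)).
Qed.

HB.instance Definition _ :=
  GRing.Lmodule_isLalgebra.Build k (trivext M) trivext_scaleAl.

Fact trivext_scaleAr (c : k) x y : c *: (x * y) = x * (c *: y).
Proof.
case: x y => a m [b n]; congr pair; rewrite /= ?scalerAr //.
by rewrite scalerDr (bilinZr (lact_bilin M)) (bilinZr (ract_bilin M)).
Qed.

HB.instance Definition _ :=
  GRing.Lalgebra_isAlgebra.Build k (trivext M) trivext_scaleAr.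

Lemma trivextM x y :
  x * y = (x.1 * y.1, lact x.1 y.2 + ract x.2 y.1) :> trivext M.
Proof. by []. Qed.

Lemma trivextD x y : x + y = (x.1 + y.1, x.2 + y.2) :> trivext M.
Proof. by []. Qed.

(** An inverse in a corner lifts along the square-zero ideal [M]. *)
Lemma trivext_inv (e b : A) (x : trivext M) :
  let e' : trivext M := (e, 0) in
  let y : trivext M := (b, - lact b (ract x.2 b)) in
  e' * x = x -> x * e' = x -> e * b = b -> b * e = b ->
  x.1 * b = e -> b * x.1 = e ->
  [/\ x * y = e', y * x = e', e' * y = y & y * e' = y].
Proof.
case: x => a m e' y /(congr1 snd) /= em /(congr1 snd) /= me eb be ab ba.
rewrite (bilin0l (ract_bilin M)) addr0 in em.
rewrite (bilin0r (lact_bilin M)) add0r in me.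
split; rewrite trivextM /= ?ab ?ba ?eb ?be; congr pair.
- by rewrite (bilinNr (lact_bilin M)) -lactM ab lact_ract em addrC subrr.
- by rewrite (bilinNl (ract_bilin M)) -lact_ract -ractM ba me subrr.
- by rewrite (bilinNr (lact_bilin M)) -lactM eb (bilin0l (ract_bilin M)) addr0.
- by rewrite (bilinNl (ract_bilin M)) -lact_ract -ractM be (bilin0r (lact_bilin M)) add0r.
Qed.

End TrivialExtension.

Record derivation (k : fieldType) (A : algType k) (M : bimodule A) (D : A -> M)
    : Prop := Derivation {
  der_lin : linear D;
  der_leibniz : forall a b, D (a * b) = lact a (D b) + ract (D a) b }.

Section DerivationTheory.
Variables (k : fieldType) (A : algType k) (M : bimodule A).
Implicit Types (D : A -> M).

Lemma derD D : derivation D -> {morph D : a b / a + b}.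
Proof. by move=> [l _] a b; have := l 1 a b; rewrite !scale1r. Qed.

Lemma der0 D : derivation D -> D 0 = 0.
Proof. by move=> dD; apply: (addrI (D 0)); rewrite -(derD dD) !addr0. Qed.

Lemma derZ D : derivation D -> forall c a, D (c *: a) = c *: D a.
Proof. by move=> dD c a; have := der_lin dD c a 0; rewrite (der0 dD) !addr0. Qed.

Lemma der_zero : derivation (fun=> 0 : M).
Proof.
split=> [c x y|x y] /=; first by rewrite scaler0 addr0.
by rewrite (bilin0r (lact_bilin M)) (bilin0l (ract_bilin M)) addr0.
Qed.

Lemma inner_der (m : M) : derivation (fun a => lact a m - ract m a).
Proof.
split=> [c a b|a b].
  by rewrite (lact_bilin M).1 (ract_bilin M).2 scalerBr opprD addrACA.
rewrite (bilinDr (lact_bilin M)) (bilinNr (lact_bilin M)) (bilinDl (ract_bilin M)).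
by rewrite (bilinNl (ract_bilin M)) lactM ractM lact_ract addrA subrK.
Qed.

(** The formula for the derivative of an inverse, in a corner. *)
Lemma der_inv D e a b : derivation D -> D e = 0 -> a * b = e -> b * a = e ->
  b * e = b -> D b = - lact b (ract (D a) b).
Proof.
move=> dD De ab ba be.
have : ract (D (b * a)) b = 0 by rewrite ba De (bilin0l (ract_bilin M)).
rewrite (der_leibniz dD) (bilinDl (ract_bilin M)) -lact_ract -ractM ab.
have -> : ract (D b) e = D b.
  by rewrite -{2}be (der_leibniz dD) De (bilin0r (lact_bilin M)) add0r.
by move/eqP; rewrite addrC addr_eq0 => /eqP.
Qed.

End DerivationTheory.

Section BoalchDerivations.
Variables (k : fieldType) (M : bimodule (boalch k)).
Implicit Types (D : boalch k -> M).

Lemma der_ext D D' : derivation D -> derivation D' ->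
  (forall i, D (be k i) = D' (be k i)) -> (forall a, D (bv k a) = D' (bv k a)) ->
  D =1 D'.
Proof.
move=> dD dD' eDe eDv.
pose E x := D x - D' x.
have dE : derivation E.
  split=> [c x y|x y]; rewrite /E.
  - by rewrite (der_lin dD) (der_lin dD') scalerBr opprD addrACA.
  - rewrite (der_leibniz dD) (der_leibniz dD') opprD addrACA.
    rewrite (bilinDr (lact_bilin M)) (bilinNr (lact_bilin M)).
    by rewrite (bilinDl (ract_bilin M)) (bilinNl (ract_bilin M)).
have Ee i : E (be k i) = 0 by rewrite /E eDe subrr.
have bP : boalch_family (bgen k) := @bgen_family k.
case/boalch_familyP: (bP) => pP _ gV Vg _.
move=> x; apply/eqP; rewrite -subr_eq0 -/(E x); apply/eqP; elim/boalch_ind: x.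
- by move=> x y Ex Ey; rewrite (derD dE) Ex Ey addr0.
- by move=> c x Ex; rewrite (derZ dE) Ex scaler0.
- move=> x y Ex Ey.
  by rewrite (der_leibniz dE) Ex Ey (bilin0r (lact_bilin M)) (bilin0l (ract_bilin M)) addr0.
- exact: Ee.
- by move=> a; rewrite /E eDv subrr.
- move=> i Eg; have pi := path_tgt pP (Gi i).
  rewrite (der_inv dE (Ee i) (gV i) (Vg i) pi) [E _]Eg.
  by rewrite (bilin0l (ract_bilin M)) (bilin0r (lact_bilin M)) oppr0.
Qed.

(** The family [(e_i, 0)], [(v_a, m a)] in the square-zero extension defines an
    algebra morphism because [gamma_3] and [gamma_1^-1], being polynomials in the
    arrows, keep their inverses there; its second component is the derivation. *)
Lemma der_exists (m : arrow -> M) :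
  (forall a, lact (be k (val a).1) (m a) = m a) ->
  (forall a, ract (m a) (be k (val a).2) = m a) ->
  exists D, [/\ derivation D, forall i, D (be k i) = 0 & forall a, D (bv k a) = m a].
Proof.
move=> sm tm.
have bP : boalch_family (bgen k) := @bgen_family k.
case/boalch_familyP: (bP) => pP sum_e gV Vg _.
pose B := boalch k; pose T := trivext M.
(* [f] suffices to lift gamma_3 and gamma_1^-1, which are polynomials in the arrows;
   [f'] also contains the inverses of these lifts. *)
pose f x : T := match x with
  | Gen_e i => (be k i, 0) | Gen_v a => (bv k a, m a)
  | _ => 0 end.
have fP : path_family f.
  split.
  - move=> i j; rewrite trivextM /= (bilin0r (lact_bilin M)) (bilin0l (ract_bilin M)) addr0.
    by rewrite /be (path_e pP); case: eqP.
  - case=> [i|a|a|i|i]; rewrite /f ?mulr0 // trivextM /= ?(bilin0l (ract_bilin M)) ?addr0.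
      by rewrite (bilin0r (lact_bilin M)) /be (path_e pP) eqxx.
    by rewrite sm; congr pair; exact: (path_src pP (Gv a)).
  - case=> [i|a|a|i|i]; rewrite /f ?mul0r // trivextM /= ?(bilin0r (lact_bilin M)) ?add0r.
      by rewrite (bilin0l (ract_bilin M)) /be (path_e pP) eqxx.
    by rewrite tm; congr pair; exact: (path_tgt pP (Gv a)).
have M33_1 : (M33 f).1 = bg k i3 by rewrite [bg _ _](gamma3E bP).
have C11_1 : (C11 f).1 = bginv k i1 by rewrite [bginv _ _](ginv1E bP).
have M33_s : (f (Ge i3)) * M33 f = M33 f by rewrite /M33; path_ring fP.
have M33_t : M33 f * (f (Ge i3)) = M33 f by rewrite /M33; path_ring fP.
have C11_s : (f (Ge i1)) * C11 f = C11 f by rewrite /C11; path_ring fP.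
have C11_t : C11 f * (f (Ge i1)) = C11 f by rewrite /C11; path_ring fP.
have [||||||Cq qC q_s q_t] := @trivext_inv _ _ M (be k i1) (bg k i1) (C11 f) => //.
- exact: (path_src pP (Gg i1)).
- exact: (path_tgt pP (Gg i1)).
- by rewrite C11_1 Vg.
- by rewrite C11_1 gV.
have [||||||Mp pM p_s p_t] := @trivext_inv _ _ M (be k i3) (bginv k i3) (M33 f) => //.
- exact: (path_src pP (Gi i3)).
- exact: (path_tgt pP (Gi i3)).
- by rewrite M33_1 gV.
- by rewrite M33_1 Vg.
pose f' x : T := match x with
  | Gen_e i => (be k i, 0) | Gen_v a => (bv k a, m a)
  | Gen_g i => if i == i1 then (bg k i1, - lact (bg k i1) (ract (C11 f).2 (bg k i1))) else 0
  | Gen_ginv i => if i == i3 then (bginv k i3, - lact (bginv k i3) (ract (M33 f).2 (bginv k i3))) else 0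
  | _ => 0 end.
have f'P : path_family f'.
  split; first exact: path_e fP.
  - case=> [i|a|a|i|i].
    + exact: path_src fP (Ge i).
    + exact: path_src fP (Gv a).
    + by rewrite mulr0.
    + by elim/ord3P: i; rewrite ?mulr0 //; exact: q_s.
    + by elim/ord3P: i; rewrite ?mulr0 //; exact: p_s.
  - case=> [i|a|a|i|i].
    + exact: path_tgt fP (Ge i).
    + exact: path_tgt fP (Gv a).
    + by rewrite mul0r.
    + by elim/ord3P: i; rewrite ?mul0r //; exact: q_t.
    + by elim/ord3P: i; rewrite ?mul0r //; exact: p_t.
have sum_f : \sum_i f' (Ge i) = 1.
  have -> : 1 = (1, 0) :> T by [].
  by rewrite -sum_e !sum_ord3 !trivextD /= !addr0.
have := boalch_liftP (complete_boalch f'P sum_f pM Mp qC Cq).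
move: (boalch_lift _) => L [Lin Mul Gen].
have Le i : L (be k i) = (be k i, 0) by rewrite /be Gen.
have Lv a : L (bv k a) = (bv k a, m a) by rewrite /bv Gen.
have L1 x : (L x).1 = x.
  have LD u v : L (u + v) = L u + L v.
    by have := Lin 1 u v; rewrite !scale1r.
  have L0 : L 0 = 0 by apply: (addrI (L 0)); rewrite -LD !addr0.
  elim/boalch_ind: x.
  - by move=> x y Lx Ly; rewrite LD /= Lx Ly.
  - by move=> c x Lx; have := Lin c x 0; rewrite L0 !addr0 => -> /=; rewrite Lx.
  - by move=> x y Lx Ly; rewrite Mul /= Lx Ly.
  - by move=> i; rewrite Le.
  - by move=> a; rewrite Lv.
  - move=> i Lg; set x := bginv k i.
    have Lx : (L x).1 * be k i = (L x).1.
      have /(congr1 L) : x * be k i = x := path_tgt pP (Gi i).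
      by rewrite Mul Le => /(congr1 fst).
    have Lxg : (L x).1 * bg k i = be k i.
      have /(congr1 L) : x * bg k i = be k i := Vg i.
      by rewrite Mul Le => /(congr1 fst) /=; rewrite Lg.
    by rewrite -Lx -[be k i](gV i) mulrA Lxg; exact: (path_src pP (Gi i)).
exists (fun x => (L x).2); split=> [|i|a]; [ | by rewrite Le | by rewrite Lv].
split=> [c x y|x y]; first by rewrite Lin.
by rewrite Mul /= !L1.
Qed.

End BoalchDerivations.

(** * Tensor products *)

Section TensorTheory.
Variables (k : fieldType) (U V : lmodType k).

Lemma tens_bilin : bilin (@tens k U V).
Proof. by split=> [v c u u'|u c v v']; rewrite ?tensDl ?tensZl ?tensDr ?tensZr. Qed.

Lemma tens0l v : tens (0 : U) v = 0 :> tensor U V.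
Proof. exact: bilin0l tens_bilin v. Qed.

Lemma tens0r u : tens u (0 : V) = 0 :> tensor U V.
Proof. exact: bilin0r tens_bilin u. Qed.

(** Scalars are absorbed by the first factor, so pure tensors generate the tensor
    product additively. *)
Lemma tensor_ind (P : tensor U V -> Prop) :
  P 0 -> (forall x y, P x -> P y -> P (x + y)) -> (forall u v, P (tens u v)) ->
  forall x, P x.
Proof.
move=> P0 PD Pt; elim/quotW=> x; rewrite [x]monalgE.
elim/big_ind: _ => [|y z Py Pz|[u v] _].
- by rewrite [X in P X]raddf0.
- by rewrite [X in P X]raddfD; exact: (PD).
- rewrite (_ : << _ *g _ >> = x@_(u, v) *: << (u, v) >>).
    by rewrite tensor_piZ -tensE -[tensor_scale _ _]tensZl.
  by apply/malgP=> m; rewrite mcoeffZ !mcoeffU mulr_natr.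
Qed.

Section Lift.
Variables (W : lmodType k) (f : U -> V -> W).
Hypothesis fP : bilin f.

Lemma tliftD : {morph tlift f : x y / x + y}.
Proof. by move=> x y; have := tlift_linear fP 1 x y; rewrite !scale1r. Qed.

Lemma tlift0 : tlift f 0 = 0.
Proof. by apply: (addrI (tlift f 0)); rewrite -tliftD !addr0. Qed.

Lemma tliftZ c x : tlift f (c *: x) = c *: tlift f x.
Proof. by have := tlift_linear fP c x 0; rewrite tlift0 !addr0. Qed.

Lemma tliftN x : tlift f (- x) = - tlift f x.
Proof. by rewrite -[- x]scaleN1r tliftZ scaleN1r. Qed.

End Lift.

End TensorTheory.

Section Actions.
Variables (k : fieldType) (A : algType k).

Local Notation T2 := (tensor A A).
Local Notation T3 := (tensor (tensor A A) A).

(** The bimodule structure of [A (x) A] on the inside: [x] multiplies the second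
    factor from the left and [y] the first one from the right. *)
Definition inner (x : A) (t : T2) (y : A) : T2 :=
  tlift (fun a b => tens (a * y) (x * b)) t.

Definition outer3 (x : A) (t : T3) (y : A) : T3 :=
  tlift (fun s c => tens (outer x s 1) (c * y)) t.

Lemma outer_bilin (x y : A) : bilin (fun a b : A => tens (x * a) (b * y) : T2).
Proof.
split=> [v c u u'|u c v v'].
  by rewrite mulrDr -scalerAr tensDl tensZl.
by rewrite mulrDl -scalerAl tensDr tensZr.
Qed.

Lemma inner_bilin (x y : A) : bilin (fun a b : A => tens (a * y) (x * b) : T2).
Proof.
split=> [v c u u'|u c v v'].
  by rewrite mulrDl -scalerAl tensDl tensZl.
by rewrite mulrDr -scalerAr tensDr tensZr.
Qed.

Lemma tau_bilin : bilin (fun a b : A => tens b a : T2).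
Proof. by split=> [v c u u'|u c v v']; rewrite ?tensDl ?tensZl ?tensDr ?tensZr. Qed.

Lemma outer_tens x y a b : outer x (tens a b) y = tens (x * a) (b * y) :> T2.
Proof. exact: tlift_tens (outer_bilin x y) a b. Qed.

Lemma outerD x y : {morph (fun t : T2 => outer x t y) : s t / s + t}.
Proof. exact: tliftD (outer_bilin x y). Qed.

Lemma outer0 x y : outer x 0 y = 0 :> T2.
Proof. exact: tlift0 (outer_bilin x y). Qed.

Lemma outerZ x y c (t : T2) : outer x (c *: t) y = c *: outer x t y.
Proof. exact: tliftZ (outer_bilin x y) c t. Qed.

Lemma inner_tens x y a b : inner x (tens a b) y = tens (a * y) (x * b) :> T2.
Proof. exact: tlift_tens (inner_bilin x y) a b. Qed.

Lemma innerD x y : {morph (fun t : T2 => inner x t y) : s t / s + t}.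
Proof. exact: tliftD (inner_bilin x y). Qed.

Lemma inner0 x y : inner x 0 y = 0 :> T2.
Proof. exact: tlift0 (inner_bilin x y). Qed.

Lemma innerZ x y c (t : T2) : inner x (c *: t) y = c *: inner x t y.
Proof. exact: tliftZ (inner_bilin x y) c t. Qed.

Lemma tau12_tens a b : tau12 (tens a b) = tens b a :> T2.
Proof. exact: tlift_tens tau_bilin a b. Qed.

Lemma tau12D : {morph (@tau12 k A) : s t / s + t}.
Proof. exact: tliftD tau_bilin. Qed.

Lemma tau12_0 : tau12 0 = 0 :> T2.
Proof. exact: tlift0 tau_bilin. Qed.

Lemma tau12Z c (t : T2) : tau12 (c *: t) = c *: tau12 t.
Proof. exact: tliftZ tau_bilin c t. Qed.

Lemma tau12K : involutive (@tau12 k A).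
Proof.
elim/tensor_ind=> [|s t Hs Ht|a b]; first by rewrite !tau12_0.
  by rewrite !tau12D Hs Ht.
by rewrite !tau12_tens.
Qed.

Lemma outer3_bilin (x y : A) :
  bilin (fun (s : T2) (c : A) => tens (outer x s 1) (c * y) : T3).
Proof.
split=> [v c u u'|u c v v'].
  by rewrite outerD outerZ tensDl tensZl.
by rewrite mulrDl -scalerAl tensDr tensZr.
Qed.

Lemma outer3_tens x y (s : T2) c : outer3 x (tens s c) y = tens (outer x s 1) (c * y).
Proof. exact: tlift_tens (outer3_bilin x y) s c. Qed.

Lemma outer3D x y : {morph (fun t : T3 => outer3 x t y) : s t / s + t}.
Proof. exact: tliftD (outer3_bilin x y). Qed.

Lemma outer30 x y : outer3 x 0 y = 0.
Proof. exact: tlift0 (outer3_bilin x y). Qed.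

Lemma outer3Z x y c (t : T3) : outer3 x (c *: t) y = c *: outer3 x t y.
Proof. exact: tliftZ (outer3_bilin x y) c t. Qed.

Lemma outer_outer x x' y y' (t : T2) :
  outer x (outer x' t y') y = outer (x * x') t (y' * y).
Proof.
elim/tensor_ind: t => [|s t Hs Ht|a b]; first by rewrite !outer0.
  by rewrite !outerD Hs Ht.
by rewrite !outer_tens !mulrA.
Qed.

Lemma inner_inner x x' y y' (t : T2) :
  inner x (inner x' t y') y = inner (x * x') t (y' * y).
Proof.
elim/tensor_ind: t => [|s t Hs Ht|a b]; first by rewrite !inner0.
  by rewrite !innerD Hs Ht.
by rewrite !inner_tens !mulrA.
Qed.

Lemma inner_outer x x' y y' (t : T2) :
  inner x (outer x' t y') y = outer x' (inner x t y) y'.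
Proof.
elim/tensor_ind: t => [|s t Hs Ht|a b]; first by rewrite !(inner0, outer0).
  by rewrite !(innerD, outerD) Hs Ht.
by rewrite !(inner_tens, outer_tens) !mulrA.
Qed.

(** The flip exchanges the two bimodule structures; this is why antisymmetry turns
    the Leibniz rule in the second argument into one in the first. *)
Lemma tau12_outer x y (t : T2) : tau12 (outer x t y) = inner x (tau12 t) y.
Proof.
elim/tensor_ind: t => [|s t Hs Ht|a b]; first by rewrite !(inner0, outer0, tau12_0).
  by rewrite !(innerD, outerD, tau12D) Hs Ht.
by rewrite !(inner_tens, outer_tens, tau12_tens).
Qed.

Lemma tau12_inner x y (t : T2) : tau12 (inner x t y) = outer x (tau12 t) y.
Proof. by rewrite -[t in LHS]tau12K -tau12_outer tau12K. Qed.

Lemma outerN x y (t : T2) : outer x (- t) y = - outer x t y.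
Proof. exact: tliftN (outer_bilin x y) t. Qed.

Lemma innerN x y (t : T2) : inner x (- t) y = - inner x t y.
Proof. exact: tliftN (inner_bilin x y) t. Qed.

Lemma tau12N (t : T2) : tau12 (- t) = - tau12 t.
Proof. exact: tliftN tau_bilin t. Qed.

Lemma outer11 (t : T2) : outer 1 t 1 = t.
Proof.
elim/tensor_ind: t => [|s t Hs Ht|a b]; first by rewrite outer0.
  by rewrite outerD Hs Ht.
by rewrite outer_tens mulr1 mul1r.
Qed.

Lemma inner11 (t : T2) : inner 1 t 1 = t.
Proof.
elim/tensor_ind: t => [|s t Hs Ht|a b]; first by rewrite inner0.
  by rewrite innerD Hs Ht.
by rewrite inner_tens mulr1 mul1r.
Qed.

Lemma outer_linl y (t : T2) : linear (fun x => outer x t y).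
Proof.
move=> c x x'; elim/tensor_ind: t => [|s t Hs Ht|a b].
- by rewrite !outer0 scaler0 addr0.
- by rewrite !outerD Hs Ht scalerDr addrACA.
- by rewrite !outer_tens mulrDl -scalerAl tensDl tensZl.
Qed.

Lemma outer_linr x (t : T2) : linear (outer x t).
Proof.
move=> c y y'; elim/tensor_ind: t => [|s t Hs Ht|a b].
- by rewrite !outer0 scaler0 addr0.
- by rewrite !outerD Hs Ht scalerDr addrACA.
- by rewrite !outer_tens mulrDr -scalerAr tensDr tensZr.
Qed.

Lemma inner_linl y (t : T2) : linear (fun x => inner x t y).
Proof.
move=> c x x'; elim/tensor_ind: t => [|s t Hs Ht|a b].
- by rewrite !inner0 scaler0 addr0.
- by rewrite !innerD Hs Ht scalerDr addrACA.
- by rewrite !inner_tens mulrDl -scalerAl tensDr tensZr.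
Qed.

Lemma inner_linr x (t : T2) : linear (inner x t).
Proof.
move=> c y y'; elim/tensor_ind: t => [|s t Hs Ht|a b].
- by rewrite !inner0 scaler0 addr0.
- by rewrite !innerD Hs Ht scalerDr addrACA.
- by rewrite !inner_tens mulrDr -scalerAr tensDl tensZl.
Qed.

Lemma outer3_outer3 x x' y y' (t : T3) :
  outer3 x (outer3 x' t y') y = outer3 (x * x') t (y' * y).
Proof.
elim/tensor_ind: t => [|s t Hs Ht|a b]; first by rewrite !outer30.
  by rewrite !outer3D Hs Ht.
by rewrite !outer3_tens outer_outer mulr1 mulrA.
Qed.

Lemma outer311 (t : T3) : outer3 1 t 1 = t.
Proof.
elim/tensor_ind: t => [|s t Hs Ht|a b]; first by rewrite outer30.
  by rewrite outer3D Hs Ht.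
by rewrite outer3_tens outer11 mulr1.
Qed.

Lemma outer3_linl y (t : T3) : linear (fun x => outer3 x t y).
Proof.
move=> c x x'; elim/tensor_ind: t => [|s t Hs Ht|a b].
- by rewrite !outer30 scaler0 addr0.
- by rewrite !outer3D Hs Ht scalerDr addrACA.
- by rewrite !outer3_tens outer_linl tensDl tensZl.
Qed.

Lemma outer3_linr x (t : T3) : linear (outer3 x t).
Proof.
move=> c y y'; elim/tensor_ind: t => [|s t Hs Ht|a b].
- by rewrite !outer30 scaler0 addr0.
- by rewrite !outer3D Hs Ht scalerDr addrACA.
- by rewrite !outer3_tens mulrDr -scalerAr tensDr tensZr.
Qed.

Definition outer_bimodule : bimodule A.
Proof.
apply: (@Bimodule k A T2 (fun a t => outer a t 1) (fun t b => outer 1 t b)).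
- by split=> [t|a c s t]; [exact: outer_linl | rewrite outerD outerZ].
- by split=> [b c s t|t]; [rewrite outerD outerZ | exact: outer_linr].
- exact: outer11.
- exact: outer11.
- by move=> a b t; rewrite outer_outer mulr1.
- by move=> t a b; rewrite outer_outer mulr1.
- by move=> a t b; rewrite !outer_outer !(mul1r, mulr1).
Defined.

Definition inner_bimodule : bimodule A.
Proof.
apply: (@Bimodule k A T2 (fun a t => inner a t 1) (fun t b => inner 1 t b)).
- by split=> [t|a c s t]; [exact: inner_linl | rewrite innerD innerZ].
- by split=> [b c s t|t]; [rewrite innerD innerZ | exact: inner_linr].
- exact: inner11.
- exact: inner11.
- by move=> a b t; rewrite inner_inner mulr1.
- by move=> t a b; rewrite inner_inner mulr1.
- by move=> a t b; rewrite !inner_inner !(mul1r, mulr1).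
Defined.

Definition outer3_bimodule : bimodule A.
Proof.
apply: (@Bimodule k A T3 (fun a t => outer3 a t 1) (fun t b => outer3 1 t b)).
- by split=> [t|a c s t]; [exact: outer3_linl | rewrite outer3D outer3Z].
- by split=> [b c s t|t]; [rewrite outer3D outer3Z | exact: outer3_linr].
- exact: outer311.
- exact: outer311.
- by move=> a b t; rewrite outer3_outer3 mulr1.
- by move=> t a b; rewrite outer3_outer3 mulr1.
- by move=> a t b; rewrite !outer3_outer3 !(mul1r, mulr1).
Defined.

Lemma tau12_der_outer (D : A -> outer_bimodule) :
  derivation D -> @derivation k A inner_bimodule (fun x => - tau12 (D x)).
Proof.
move=> dD; split=> [c x y|x y].
  by rewrite (der_lin dD) tau12D tau12Z opprD scalerN.
by rewrite (der_leibniz dD) /= tau12D !tau12_outer opprD !innerN.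
Qed.

Lemma tau12_der_inner (D : A -> inner_bimodule) :
  derivation D -> @derivation k A outer_bimodule (fun x => - tau12 (D x)).
Proof.
move=> dD; split=> [c x y|x y].
  by rewrite (der_lin dD) tau12D tau12Z opprD scalerN.
by rewrite (der_leibniz dD) /= tau12D !tau12_inner opprD !outerN.
Qed.

End Actions.

(** * The triple bracket of a double bracket *)

Section Tau.
Variables (k : fieldType) (A : algType k).

Local Notation T2 := (tensor A A).
Local Notation T3 := (tensor (tensor A A) A).

Lemma tens3Dl (a a' b c : A) : tens3 (a + a') b c = tens3 a b c + tens3 a' b c.
Proof. by rewrite /tens3 !tensDl. Qed.
Lemma tens3Dm (a b b' c : A) : tens3 a (b + b') c = tens3 a b c + tens3 a b' c.
Proof. by rewrite /tens3 tensDr tensDl. Qed.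
Lemma tens3Dr (a b c c' : A) : tens3 a b (c + c') = tens3 a b c + tens3 a b c'.
Proof. by rewrite /tens3 tensDr. Qed.
Lemma tens3Zl x (a b c : A) : tens3 (x *: a) b c = x *: tens3 a b c.
Proof. by rewrite /tens3 !tensZl. Qed.
Lemma tens3Zm x (a b c : A) : tens3 a (x *: b) c = x *: tens3 a b c.
Proof. by rewrite /tens3 tensZr tensZl. Qed.
Lemma tens3Zr x (a b c : A) : tens3 a b (x *: c) = x *: tens3 a b c.
Proof. by rewrite /tens3 tensZr. Qed.

Lemma tens3_perm_bilin (c : A) :
  bilin (fun a b : A => tens3 c a b) /\ bilin (fun a b : A => tens3 b c a).
Proof.
by split; split=> [v x u u'|u x v v']; rewrite ?tens3Dl ?tens3Dm ?tens3Dr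
   ?tens3Zl ?tens3Zm ?tens3Zr.
Qed.

Lemma tau123_bilin :
  bilin (fun (t : T2) (c : A) => tlift (fun a b => tens3 c a b) t).
Proof.
split=> [c|t]; first exact: tlift_linear (tens3_perm_bilin c).1.
move=> x c c'; elim/tensor_ind: t => [|s t Hs Ht|a b].
- by rewrite !(tlift0 (tens3_perm_bilin _).1) scaler0 addr0.
- by rewrite !(tliftD (tens3_perm_bilin _).1) Hs Ht scalerDr addrACA.
- by rewrite !(tlift_tens (tens3_perm_bilin _).1) tens3Dl tens3Zl.
Qed.

Lemma tau132_bilin :
  bilin (fun (t : T2) (c : A) => tlift (fun a b => tens3 b c a) t).
Proof.
split=> [c|t]; first exact: tlift_linear (tens3_perm_bilin c).2.
move=> x c c'; elim/tensor_ind: t => [|s t Hs Ht|a b].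
- by rewrite !(tlift0 (tens3_perm_bilin _).2) scaler0 addr0.
- by rewrite !(tliftD (tens3_perm_bilin _).2) Hs Ht scalerDr addrACA.
- by rewrite !(tlift_tens (tens3_perm_bilin _).2) tens3Dm tens3Zm.
Qed.

Lemma tau123_tens3 (a b c : A) : tau123 (tens3 a b c) = tens3 c a b.
Proof.
by rewrite /tau123 {1}/tens3 (tlift_tens tau123_bilin) (tlift_tens (tens3_perm_bilin _).1).
Qed.

Lemma tau132_tens3 (a b c : A) : tau132 (tens3 a b c) = tens3 b c a.
Proof.
by rewrite /tau132 {1}/tens3 (tlift_tens tau132_bilin) (tlift_tens (tens3_perm_bilin _).2).
Qed.

Lemma tau123D : {morph (@tau123 k A) : s t / s + t}.
Proof. exact: tliftD tau123_bilin. Qed.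
Lemma tau123_0 : tau123 (0 : T3) = 0.
Proof. exact: tlift0 tau123_bilin. Qed.
Lemma tau123Z c (t : T3) : tau123 (c *: t) = c *: tau123 t.
Proof. exact: tliftZ tau123_bilin c t. Qed.
Lemma tau132D : {morph (@tau132 k A) : s t / s + t}.
Proof. exact: tliftD tau132_bilin. Qed.
Lemma tau132_0 : tau132 (0 : T3) = 0.
Proof. exact: tlift0 tau132_bilin. Qed.
Lemma tau132Z c (t : T3) : tau132 (c *: t) = c *: tau132 t.
Proof. exact: tliftZ tau132_bilin c t. Qed.

Lemma tensor3_ind (P : T3 -> Prop) :
  P 0 -> (forall x y, P x -> P y -> P (x + y)) -> (forall a b c, P (tens3 a b c)) ->
  forall x, P x.
Proof.
move=> P0 PD Pt; elim/tensor_ind=> // t c; elim/tensor_ind: t => [|s t Ps Pt'|a b].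
- by rewrite tens0l.
- by rewrite tensDl; exact: (PD).
- exact: Pt.
Qed.

Lemma tau132_132 (t : T3) : tau132 (tau132 t) = tau123 t.
Proof.
elim/tensor3_ind: t => [|s t Hs Ht|a b c]; first by rewrite !(tau132_0, tau123_0).
  by rewrite !(tau132D, tau123D) Hs Ht.
by rewrite !(tau132_tens3, tau123_tens3).
Qed.

Lemma tau132_123 (t : T3) : tau132 (tau123 t) = t.
Proof.
elim/tensor3_ind: t => [|s t Hs Ht|a b c]; first by rewrite !(tau132_0, tau123_0).
  by rewrite !(tau132D, tau123D) Hs Ht.
by rewrite !(tau132_tens3, tau123_tens3).
Qed.

(** The product of [s] and [t] over the common middle tensor factor, which
    collects the terms of the triple bracket that are not derivations. *)
Definition mix (s t : T2) : T3 := tlift (fun x y => tens (outer 1 s x) y) t.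

Lemma mix_bilin (s : T2) : bilin (fun x y : A => tens (outer 1 s x) y : T3).
Proof.
split=> [v x u u'|u x v v'].
  by rewrite outer_linr tensDl tensZl.
by rewrite tensDr tensZr.
Qed.

Lemma mixDr s : {morph mix s : t u / t + u}.
Proof. exact: tliftD (mix_bilin s). Qed.
Lemma mix0r s : mix s 0 = 0.
Proof. exact: tlift0 (mix_bilin s). Qed.
Lemma mix_tens s x y : mix s (tens x y) = tens (outer 1 s x) y.
Proof. exact: tlift_tens (mix_bilin s) x y. Qed.
Lemma mixDl t : {morph mix^~ t : s u / s + u}.
Proof.
move=> s u; elim/tensor_ind: t => [|t v Ht Hv|a b].
- by rewrite !mix0r addr0.
- by rewrite !mixDr Ht Hv addrACA.
- by rewrite !mix_tens outerD tensDl.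
Qed.
Lemma mix0l t : mix 0 t = 0.
Proof. by apply: (addrI (mix 0 t)); rewrite -mixDl !addr0. Qed.
Lemma mixNl s t : mix (- s) t = - mix s t.
Proof. by apply: (addrI (mix s t)); rewrite -mixDl !subrr mix0l. Qed.

End Tau.

Section BracketTheory.
Variables (k : fieldType) (A : algType k) (I : finType) (e : I -> A).
Variable br : A -> A -> tensor A A.
Hypothesis brP : double_bracket e br.

Local Notation T2 := (tensor A A).
Local Notation T3 := (tensor (tensor A A) A).

Lemma br_outer_der a : @derivation k A (outer_bimodule A) (br a).
Proof.
split; first exact: (br_bilin brP).2.
by move=> b c; rewrite (br_leibniz brP) addrC.
Qed.

Lemma br_inner_der b : @derivation k A (inner_bimodule A) (br^~ b).
Proof.
have := tau12_der_outer (br_outer_der b).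
by rewrite (_ : (fun x => _) = br^~ b) //; apply/funext => x; rewrite -(br_antisym brP).
Qed.

Lemma brL_bilin a : bilin (fun b c : A => tens (br a b) c : T3).
Proof.
split=> [v x u u'|u x v v'].
  by rewrite (br_bilin brP).2 tensDl tensZl.
by rewrite tensDr tensZr.
Qed.

Lemma brLD a : {morph brL br a : s t / s + t}.
Proof. exact: tliftD (brL_bilin a). Qed.
Lemma brL0 a : brL br a 0 = 0.
Proof. exact: tlift0 (brL_bilin a). Qed.
Lemma brLZ a c t : brL br a (c *: t) = c *: brL br a t.
Proof. exact: tliftZ (brL_bilin a) c t. Qed.
Lemma brL_tens a b c : brL br a (tens b c) = tens (br a b) c.
Proof. exact: tlift_tens (brL_bilin a) b c. Qed.

Lemma brL_linl t : linear (brL br ^~ t).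
Proof.
move=> c a a'; elim/tensor_ind: t => [|t v Ht Hv|x y].
- by rewrite !brL0 scaler0 addr0.
- by rewrite !brLD Ht Hv scalerDr addrACA.
- by rewrite !brL_tens (br_bilin brP).1 tensDl tensZl.
Qed.

(** The three summands of the triple bracket are permuted cyclically. *)
Lemma triple_cyclic a b c :
  triple_bracket br b c a = tau132 (triple_bracket br a b c).
Proof.
by rewrite /triple_bracket !tau132D tau132_123 tau132_132 [LHS]addrC addrA.
Qed.

Let brM a c d : br a (c * d) = outer 1 (br a c) d + outer c (br a d) 1 := br_leibniz brP a c d.
Let brMl c d a : br (c * d) a = inner c (br d a) 1 + inner 1 (br c a) d :=
  der_leibniz (br_inner_der a) c d.

Lemma brL_outerr a d t : brL br a (outer 1 t d) = outer3 1 (brL br a t) d.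
Proof.
elim/tensor_ind: t => [|t v Ht Hv|x y].
- by rewrite !(outer0, brL0, outer30).
- by rewrite !(outerD, brLD, outer3D) Ht Hv.
- by rewrite outer_tens !brL_tens outer3_tens outer11 mul1r.
Qed.

Lemma brL_outerl a c t :
  brL br a (outer c t 1) = outer3 c (brL br a t) 1 + mix (br a c) t.
Proof.
elim/tensor_ind: t => [|t v Ht Hv|x y].
- by rewrite !(outer0, brL0, outer30, mix0r) addr0.
- by rewrite !(outerD, brLD, outer3D, mixDr) Ht Hv addrACA.
- by rewrite outer_tens !brL_tens outer3_tens mix_tens !mulr1 brM tensDl addrC.
Qed.

Lemma tau123_brL_innerl b c t :
  tau123 (brL br b (inner c t 1)) = outer3 c (tau123 (brL br b t)) 1.
Proof.
elim/tensor_ind: t => [|t v Ht Hv|x y].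
- by rewrite !(inner0, brL0, tau123_0, outer30).
- by rewrite !(innerD, brLD, tau123D, outer3D) Ht Hv.
rewrite inner_tens !brL_tens mulr1; elim/tensor_ind: (br b x) => [|t v Ht Hv|p q].
- by rewrite !(tens0l, tau123_0, outer30).
- by rewrite !(tensDl, tau123D, outer3D) Ht Hv.
- by rewrite !tau123_tens3 outer3_tens outer_tens !mulr1.
Qed.

Lemma tau123_brL_innerr b d t :
  tau123 (brL br b (inner 1 t d)) =
  outer3 1 (tau123 (brL br b t)) d + mix (tau12 t) (br b d).
Proof.
elim/tensor_ind: t => [|t v Ht Hv|x y].
- by rewrite !(inner0, brL0, tau123_0, outer30, tau12_0, mix0l) addr0.
- by rewrite !(innerD, brLD, tau123D, outer3D, tau12D, mixDl) Ht Hv addrACA.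
rewrite inner_tens !brL_tens mul1r tau12_tens brM tensDl tau123D; congr (_ + _).
  elim/tensor_ind: (br b x) => [|t v Ht Hv|p q].
  - by rewrite !(outer0, tens0l, tau123_0, outer30).
  - by rewrite !(outerD, tensDl, tau123D, outer3D) Ht Hv.
  - by rewrite outer_tens !tau123_tens3 outer3_tens outer_tens !mul1r mulr1.
elim/tensor_ind: (br b d) => [|t v Ht Hv|p q].
- by rewrite !(outer0, tens0l, tau123_0, mix0r).
- by rewrite !(outerD, tensDl, tau123D, mixDr) Ht Hv.
- by rewrite outer_tens tau123_tens3 mix_tens outer_tens mul1r mulr1.
Qed.

Lemma tau132_brLM c d t :
  tau132 (brL br (c * d) t) =
  outer3 c (tau132 (brL br d t)) 1 + outer3 1 (tau132 (brL br c t)) d.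
Proof.
elim/tensor_ind: t => [|t v Ht Hv|x y].
- by rewrite !(brL0, tau132_0, outer30) addr0.
- by rewrite !(brLD, tau132D, outer3D) Ht Hv addrACA.
rewrite !brL_tens brMl tensDl tau132D; congr (_ + _).
  elim/tensor_ind: (br d x) => [|t v Ht Hv|p q].
  - by rewrite !(inner0, tens0l, tau132_0, outer30).
  - by rewrite !(innerD, tensDl, tau132D, outer3D) Ht Hv.
  - by rewrite inner_tens !tau132_tens3 outer3_tens outer_tens !mulr1.
elim/tensor_ind: (br c x) => [|t v Ht Hv|p q].
- by rewrite !(inner0, tens0l, tau132_0, outer30).
- by rewrite !(innerD, tensDl, tau132D, outer3D) Ht Hv.
- by rewrite inner_tens !tau132_tens3 outer3_tens outer_tens !mul1r mulr1.
Qed.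

(** The two [mix] terms, which come from the first and the second summand, cancel
    by antisymmetry. *)
Lemma triple_der a b : @derivation k A (outer3_bimodule A) (triple_bracket br a b).
Proof.
split=> [x c d|c d].
  rewrite /triple_bracket (br_bilin brP).2 (br_bilin brP).1 !brLD !brLZ brL_linl.
  rewrite !(tau123D, tau123Z, tau132D, tau132Z) !scalerDr.
  by rewrite [X in X + _ = _]addrACA [LHS]addrACA.
rewrite /triple_bracket brM brMl !brLD tau123D brL_outerr brL_outerl.
rewrite tau123_brL_innerl tau123_brL_innerr tau132_brLM.
rewrite (br_antisym brP a c) mixNl /= !outer3D.
set x := mix _ _; set P1 := outer3 1 _ _; set P2 := outer3 c _ _.
set P3 := outer3 c _ _; set P4 := outer3 1 _ _; set P5 := outer3 c _ _.
set P6 := outer3 1 _ _.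
rewrite (addrA P1) (addrA P3) [X in X + _ = _]addrACA addNr addr0 (addrC P1).
by rewrite [X in X + _ = _]addrACA [LHS]addrACA.
Qed.

Hypothesis eP : orthogonal_idempotents e.

Lemma in_base_e s : in_base e (e s).
Proof.
exists (fun t => (t == s)%:R); rewrite (bigD1 s) //= eqxx scale1r big1 ?addr0 // => t.
by move=> /negbTE ->; rewrite scale0r.
Qed.

Lemma br_e0 a s : br a (e s) = 0.
Proof. exact/(br_baser brP)/in_base_e. Qed.

Lemma br_0e a s : br (e s) a = 0.
Proof. exact/(br_basel brP)/in_base_e. Qed.

Lemma triple_e a b s : triple_bracket br a b (e s) = 0.
Proof.
have brL_0l t : brL br (e s) t = 0.
  elim/tensor_ind: t => [|t v Ht Hv|x y]; first exact: brL0.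
    by rewrite brLD Ht Hv addr0.
  by rewrite brL_tens br_0e tens0l.
by rewrite /triple_bracket br_e0 br_0e !brL0 brL_0l tau123_0 tau132_0 !addr0.
Qed.

End BracketTheory.

Section QPTheory.
Variables (k : fieldType) (A : algType k) (I : finType) (e : I -> A).
Hypothesis eP : orthogonal_idempotents e.

Local Notation T3 := (tensor (tensor A A) A).

(** The 3-fold qP bracket is, in its last argument, the inner derivation
    [c |-> c X - X c] for the following X. *)
Definition qP_potential (a b : A) : T3 :=
  4^-1 *: \sum_s (tens3 (e s * a) (e s * b) (e s) - tens3 (e s * a) (e s) (b * e s)
    - tens3 (e s) (a * e s * b) (e s) + tens3 (e s) (a * e s) (b * e s)).

Lemma outer3_tens3 x y (a b c : A) : outer3 x (tens3 a b c) y = tens3 (x * a) b (c * y).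
Proof. by rewrite /tens3 outer3_tens outer_tens mulr1. Qed.

Lemma outer3N x y (t : T3) : outer3 x (- t) y = - outer3 x t y.
Proof. by rewrite -[- t]scaleN1r outer3Z scaleN1r. Qed.

Lemma qP_inner a b c : qP_bracket e a b c =
  outer3 c (qP_potential a b) 1 - outer3 1 (qP_potential a b) c.
Proof.
rewrite /qP_bracket /qP_potential !outer3Z -scalerBr; congr (_ *: _).
rewrite !(big_morph _ (outer3D _ _) (outer30 _ _)) -sumrB; apply: eq_bigr => s _.
rewrite !(outer3D, outer3N, outer3_tens3) !mulr1 !mul1r !mulrA !opprD !opprK.
by rewrite !addrA.
Qed.

Lemma qP_der a b : @derivation k A (outer3_bimodule A) (qP_bracket e a b).
Proof.
have qPE c := qP_inner a b c; split=> [x c d|c d]; rewrite !qPE.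
  exact: (der_lin (@inner_der _ _ (outer3_bimodule A) _)).
exact: (der_leibniz (@inner_der _ _ (outer3_bimodule A) _)).
Qed.

Lemma qP_cyclic a b c : qP_bracket e b c a = tau132 (qP_bracket e a b c).
Proof.
have tau132N (t : T3) : tau132 (- t) = - tau132 t.
  by rewrite -[- t]scaleN1r tau132Z scaleN1r.
rewrite /qP_bracket tau132Z; congr (_ *: _).
rewrite (big_morph _ (@tau132D _ _) (tau132_0 _)); apply: eq_bigr => s _.
rewrite !(tau132D, tau132N, tau132_tens3).
by rewrite [LHS](ACl (6*8*2*4*5*7*1*3)).
Qed.

(** The outer actions of an idempotent on [qP_potential] agree. *)
Lemma qP_e a b t : qP_bracket e a b (e t) = 0.
Proof.
have te s : e t * e s = if s == t then e s else 0.
  by rewrite eP.1 eq_sym; case: eqP => // ->.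
have et s : e s * e t = if s == t then e s else 0 by rewrite eP.1.
have cancel8 (V : zmodType) (p q r u : V) : p - q - r + u - p + q + r - u = 0.
  by rewrite -[RHS](subrr (p - q - r + u)) !opprD !opprK !addrA.
rewrite /qP_bracket big1 ?scaler0 // => s _.
rewrite -(mulrA b) !te !et; case: eqP => _.
  exact: cancel8.
by rewrite !(mulr0, mul0r) /tens3 !(tens0l, tens0r) !(addr0, subr0).
Qed.

End QPTheory.

(** * Symbolic computation of brackets *)

Notation poly2 := (seq (int * (word * word))).
Notation poly3 := (seq (int * (word * word * word))).

Definition tens1 (P Q : poly1) : poly2 :=
  [seq (p.1 * q.1, (p.2, q.2)) | p <- P, q <- Q].

Definition swap2 (l : poly2) : poly2 := [seq (p.1, (p.2.2, p.2.1)) | p <- l].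

Definition outer2s (x : word) (l : poly2) (y : word) : poly2 :=
  [seq (p.1, (x ++ p.2.1, p.2.2 ++ y)) | p <- l].

Definition inner2s (x : word) (l : poly2) (y : word) : poly2 :=
  [seq (p.1, (p.2.1 ++ y, x ++ p.2.2)) | p <- l].

Definition nf2 (l : poly2) : poly2 :=
  [seq (p.1, (nf p.2.1, nf p.2.2)) | p <- l & composable p.2.1 && composable p.2.2].

Definition nf3 (l : poly3) : poly3 :=
  [seq (p.1, (nf p.2.1.1, nf p.2.1.2, nf p.2.2))
     | p <- l & [&& composable p.2.1.1, composable p.2.1.2 & composable p.2.2]].

Section SymbolicBracket.
Variable lbr : gen -> gen -> poly2.

(** The double bracket of two words expanded by the Leibniz rules, for a given
    bracket [lbr] of letters: first a letter against a word, then a word against a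
    word. *)
Fixpoint sbrl (x : gen) (w : word) : poly2 :=
  if w is y :: w' then outer2s [::] (lbr x y) w' ++ outer2s [:: y] (sbrl x w') [::]
  else [::].

Fixpoint sbr (u w : word) : poly2 :=
  if u is x :: u' then inner2s [::] (sbrl x w) u' ++ inner2s [:: x] (sbr u' w) [::]
  else [::].

Definition sbr1 (P : poly1) (w : word) : poly2 :=
  flatten [seq [seq (p.1 * q.1, q.2) | q <- sbr p.2 w] | p <- P].

Definition sbrL (u : word) (l : poly2) : poly3 :=
  flatten [seq [seq (p.1 * q.1, (q.2, p.2.2)) | q <- sbr u p.2.1] | p <- l].

Definition striple (u v w : word) : poly3 :=
  sbrL u (sbr v w)
  ++ [seq (p.1, (p.2.2, p.2.1.1, p.2.1.2)) | p <- sbrL v (sbr w u)]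
  ++ [seq (p.1, (p.2.1.2, p.2.2, p.2.1.1)) | p <- sbrL w (sbr u v)].

End SymbolicBracket.

(** Four times the summand of the qP bracket at the vertex [s]. *)
Definition sqP_at (a b c : word) (s : 'I_3) : poly3 :=
  let e := [:: Ge s] in
  [:: (1, (c ++ e ++ a, e ++ b, e)); (-1, (c ++ e ++ a, e, b ++ e));
      (-1, (c ++ e, a ++ e ++ b, e)); (1, (c ++ e, a ++ e, b ++ e));
      (-1, (e ++ a, e ++ b, e ++ c)); (1, (e ++ a, e, b ++ e ++ c));
      (1, (e, a ++ e ++ b, e ++ c)); (-1, (e, a ++ e, b ++ e ++ c))].

Definition sqP (a b c : word) : poly3 :=
  sqP_at a b c i1 ++ sqP_at a b c i2 ++ sqP_at a b c i3.

Section SymbolicTensors.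
Variables (k : fieldType) (A : algType k) (g : gen -> A).

Local Notation T2 := (tensor A A).
Local Notation T3 := (tensor (tensor A A) A).
Local Notation ev := (evw g).
Local Notation ev1 := (lincomb ev).

Definition evt2 (t : word * word) : T2 := tens (ev t.1) (ev t.2).
Definition evt3 (t : word * word * word) : T3 := tens (evt2 t.1) (ev t.2).
Local Notation ev2 := (lincomb evt2).
Local Notation ev3 := (lincomb evt3).

Lemma mulrz_bilin (U V W : lmodType k) (f : U -> V -> W) (x : U) (y : V) (c d : int) :
  bilin f -> f (x *~ c) (y *~ d) = f x y *~ (c * d).
Proof. by move=> fP; rewrite -!scaler_int (bilinZl fP) (bilinZr fP) scalerA -intrM. Qed.

Lemma ev_tens1 P Q : ev2 (tens1 P Q) = tens (ev1 P) (ev1 Q).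
Proof.
elim: P => [|[c u] P IH]; first by rewrite /lincomb !big_nil tens0l.
rewrite /tens1 /= lincomb_cat -/(tens1 P Q) IH lincomb_cons tensDl; congr (_ + _).
elim: Q {IH} => [|[d w] Q IH]; first by rewrite /lincomb !big_nil tens0r.
by rewrite /= !lincomb_cons IH tensDr (mulrz_bilin _ _ _ _ (tens_bilin A A)).
Qed.

Lemma ev_swap2 l : ev2 (swap2 l) = tau12 (ev2 l).
Proof.
rewrite (raddf_lincomb _ _ (tau12_0 A) (@tau12D _ A)) /swap2 (lincomb_map (fun t => (t.2, t.1))).
by apply: eq_lincomb => t; rewrite /= tau12_tens.
Qed.

Lemma ev_outer2s x l y : ev2 (outer2s x l y) = outer (ev x) (ev2 l) (ev y).
Proof.
rewrite [RHS](raddf_lincomb (F := fun t => outer _ t _) _ _ (outer0 _ _) (outerD _ _)).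
rewrite /outer2s (lincomb_map (fun t => (x ++ t.1, t.2 ++ y))).
by apply: eq_lincomb => t; rewrite /= outer_tens /evt2 !evw_cat.
Qed.

Lemma ev_inner2s x l y : ev2 (inner2s x l y) = inner (ev x) (ev2 l) (ev y).
Proof.
rewrite [RHS](raddf_lincomb (F := fun t => inner _ t _) _ _ (inner0 _ _) (innerD _ _)).
rewrite /inner2s (lincomb_map (fun t => (t.1 ++ y, x ++ t.2))).
by apply: eq_lincomb => t; rewrite /= inner_tens /evt2 !evw_cat.
Qed.

Section Normal.
Hypothesis gP : path_family g.

Lemma ev_nf2 l : ev2 (nf2 l) = ev2 l.
Proof.
elim: l => // -[c [u w]] l IH; rewrite /nf2 /= lincomb_cons -{}IH /=.
case: ifP => [/andP[cu cw]|/negbT]; first by rewrite lincomb_cons /evt2 /= !evw_nf.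
rewrite negb_and /evt2 /= => /orP[] /(evw_composable gP) ->.
  by rewrite tens0l mul0rz add0r.
by rewrite tens0r mul0rz add0r.
Qed.

Lemma ev_nf3 l : ev3 (nf3 l) = ev3 l.
Proof.
elim: l => // -[c [[u w] v]] l IH; rewrite /nf3 /= lincomb_cons -{}IH /=.
case: ifP => [/and3P[cu cw cv]|/negbT].
  by rewrite lincomb_cons /evt3 /evt2 /= !evw_nf.
rewrite !negb_and /evt3 /evt2 /= => /or3P[] /(evw_composable gP) ->.
- by rewrite !tens0l mul0rz add0r.
- by rewrite tens0r tens0l mul0rz add0r.
- by rewrite tens0r mul0rz add0r.
Qed.

Lemma ev2_eq l l' : balanced (nf2 (l ++ lc_opp l')) -> ev2 l = ev2 l'.
Proof.
move=> /(lincomb_balanced evt2); rewrite ev_nf2 lincomb_cat lincomb_opp.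
by move/eqP; rewrite subr_eq0 => /eqP.
Qed.

Lemma ev3_eq l l' : balanced (nf3 (l ++ lc_opp l')) -> ev3 l = ev3 l'.
Proof.
move=> /(lincomb_balanced evt3); rewrite ev_nf3 lincomb_cat lincomb_opp.
by move/eqP; rewrite subr_eq0 => /eqP.
Qed.

End Normal.

Lemma ev_sqP a b c :
  qP_bracket (fun i => g (Ge i)) (ev a) (ev b) (ev c) = 4^-1 *: ev3 (sqP a b c).
Proof.
have at_s s : ev3 (sqP_at a b c s) =
    (tens3 (ev c * g (Ge s) * ev a) (g (Ge s) * ev b) (g (Ge s))
     - tens3 (ev c * g (Ge s) * ev a) (g (Ge s)) (ev b * g (Ge s))
     - tens3 (ev c * g (Ge s)) (ev a * g (Ge s) * ev b) (g (Ge s))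
     + tens3 (ev c * g (Ge s)) (ev a * g (Ge s)) (ev b * g (Ge s))
     - tens3 (g (Ge s) * ev a) (g (Ge s) * ev b) (g (Ge s) * ev c)
     + tens3 (g (Ge s) * ev a) (g (Ge s)) (ev b * g (Ge s) * ev c)
     + tens3 (g (Ge s)) (ev a * g (Ge s) * ev b) (g (Ge s) * ev c)
     - tens3 (g (Ge s)) (ev a * g (Ge s)) (ev b * g (Ge s) * ev c)).
  rewrite /sqP_at !lincomb_cons lincomb_nil addr0 /= /evt3 /evt2 /=.
  by rewrite !evw_cat !evw1 !evw_cons !mulrA !mulr1z !mulrN1z !addrA.
apply: (congr1 (fun t => 4^-1 *: t)).
rewrite (eq_bigr _ (fun s _ => esym (at_s s))) /sqP !lincomb_cat.
rewrite !big_ord_recl big_ord0 addr0; congr (lincomb _ (sqP_at _ _ _ _) + (lincomb _ (sqP_at _ _ _ _) + lincomb _ (sqP_at _ _ _ _))); exact: val_inj.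
Qed.

(** The symbolic bracket computes [br] up to the factor [h] as soon as it does so
    on pairs of letters satisfying [good]. *)
Section Soundness.
Variables (br : A -> A -> T2) (lbr : gen -> gen -> poly2) (good : rel gen) (h : k).
Hypothesis brP : double_bracket (fun i => g (Ge i)) br.
Hypothesis lbrP : forall x y, good x y -> br (g x) (g y) = h *: ev2 (lbr x y).

Let br1l b : br 1 b = 0.
Proof.
have := der_leibniz (br_inner_der brP b) 1 1.
by rewrite lact1 ract1 mulr1 -[LHS]addr0 => /addrI.
Qed.

Let br1r a : br a 1 = 0.
Proof.
have := der_leibniz (br_outer_der brP a) 1 1.
by rewrite lact1 ract1 mulr1 -[LHS]addr0 => /addrI.
Qed.

Lemma sbrlP x w : all (good x) w -> br (g x) (ev w) = h *: ev2 (sbrl lbr x w).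
Proof.
elim: w => [_|y w IH /= /andP[xy /IH {}IH]].
  by rewrite evw_nil br1r lincomb_nil scaler0.
rewrite evw_cons (br_leibniz brP) IH lbrP // lincomb_cat !ev_outer2s.
by rewrite evw_nil evw1 !outerZ scalerDr.
Qed.

Lemma sbrP u w : allrel good u w -> br (ev u) (ev w) = h *: ev2 (sbr lbr u w).
Proof.
elim: u => [_|x u IH]; first by rewrite evw_nil br1l lincomb_nil scaler0.
rewrite allrel_consl => /andP[xw /IH {}IH].
have := der_leibniz (br_inner_der brP (ev w)) (g x) (ev u).
rewrite /= -evw_cons => ->; rewrite IH sbrlP // lincomb_cat !ev_inner2s.
by rewrite evw_nil evw1 !innerZ -scalerDr addrC.
Qed.

Lemma sbr1P P w : all (fun p => allrel good p.2 w) P ->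
  br (ev1 P) (ev w) = h *: ev2 (sbr1 lbr P w).
Proof.
elim: P => [_|[c u] P IH /= /andP[uw /IH {}IH]].
  by rewrite /lincomb !big_nil scaler0 (der0 (br_inner_der brP _)).
rewrite lincomb_cons (derD (br_inner_der brP _)) IH /sbr1 /= lincomb_cat scalerDr.
congr (_ + _); rewrite -scaler_int (derZ (br_inner_der brP _)) sbrP //.
by rewrite lincomb_scale -scaler_int !scalerA mulrC.
Qed.

Lemma sbrLP u l : all (fun p => allrel good u p.2.1) l ->
  brL br (ev u) (ev2 l) = h *: ev3 (sbrL lbr u l).
Proof.
elim: l => [_|[c [b b']] l IH /= /andP[ub /IH {}IH]].
  by rewrite /lincomb !big_nil scaler0 (brL0 brP).
rewrite lincomb_cons (brLD brP) IH /sbrL /= lincomb_cat scalerDr; congr (_ + _).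
rewrite -scaler_int (brLZ brP) /evt2 (brL_tens brP) /= sbrP // tensZl.
rewrite (_ : [seq _ | q <- _] = [seq (c * p.1, p.2) |
    p <- [seq (q.1, (q.2, b')) | q <- sbr lbr u b]]); last by rewrite -map_comp.
rewrite lincomb_scale (lincomb_map (fun t => (t, b'))) -scaler_int scalerA mulrC -scalerA.
congr (_ *: (_ *: _)).
rewrite (raddf_lincomb (F := fun t => tens t (ev b'))) //=; first exact: tens0l.
by move=> x y; rewrite tensDl.
Qed.

Definition good_first (u : word) (l : poly2) := all (fun p => allrel good u p.2.1) l.

Lemma stripleP u v w :
  allrel good v w -> allrel good w u -> allrel good u v ->
  good_first u (sbr lbr v w) -> good_first v (sbr lbr w u) ->
  good_first w (sbr lbr u v) ->
  triple_bracket br (ev u) (ev v) (ev w) = (h * h) *: ev3 (striple lbr u v w).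
Proof.
move=> vw wu uv gu gv gw; rewrite /triple_bracket !sbrP // !(brLZ brP) !sbrLP //.
rewrite tau123Z tau132Z tau123Z tau132Z !scalerA -!scalerDr; congr (_ *: _).
rewrite /striple !lincomb_cat -addrA; congr (_ + (_ + _)).
- rewrite (lincomb_map (fun t => (t.2, t.1.1, t.1.2))).
  rewrite (raddf_lincomb _ _ (tau123_0 A) (@tau123D _ A)).
  by apply: eq_lincomb => -[[a b] c]; exact: tau123_tens3.
- rewrite (lincomb_map (fun t => (t.1.2, t.2, t.1.1))).
  rewrite (raddf_lincomb _ _ (tau132_0 A) (@tau132D _ A)).
  by apply: eq_lincomb => -[[a b] c]; exact: tau132_tens3.
Qed.

End Soundness.
End SymbolicTensors.

(** * The brackets of the arrows *)

Notation v12 := (Gv a12).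
Notation v13 := (Gv a13).
Notation v21 := (Gv a21).
Notation v23 := (Gv a23).
Notation v31 := (Gv a31).
Notation v32 := (Gv a32).

(** Twice the prescribed bracket of the arrows [v_ij] and [v_kl], with the vertices
    numbered from 0.  Each unordered pair of arrows occurs once; the other order is
    supplied by antisymmetry in [arrow_bracket]. *)
Definition table (i j k l : nat) : poly2 :=
  match i, j, k, l with
  | 0, 1, 0, 2 => [:: (1, ([:: v12], [:: v13]))]%R
  | 0, 1, 2, 1 => [:: (1, ([:: v32], [:: v12]))]%R
  | 1, 0, 2, 0 => [:: (-1, ([:: v31], [:: v21]))]%R
  | 1, 0, 1, 2 => [:: (-1, ([:: v21], [:: v23]))]%R
  | 0, 2, 1, 2 => [:: (1, ([:: v23], [:: v13]))]%R
  | 0, 2, 2, 1 => [:: (-1, ([:: Ge i3], [:: v13; v32]))]%R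
  | 2, 0, 1, 2 => [:: (1, ([:: v23; v31], [:: Ge i3]))]%R
  | 2, 0, 2, 1 => [:: (-1, ([:: v31], [:: v32]))]%R
  | 0, 1, 1, 0 => [:: (-2, ([:: Ge i2], [:: Ge i1]));
      (-1, ([:: Ge i2], [:: v12; v21])); (-1, ([:: v21; v12], [:: Ge i1]))]%R
  | 0, 1, 2, 0 => [:: (-1, ([:: v31; v12], [:: Ge i1])); (-2, ([:: v32], [:: Ge i1]))]%R
  | 0, 1, 1, 2 => [:: (-1, ([:: Ge i2], [:: v12; v23])); (2, ([:: Ge i2], [:: v13]))]%R
  | 1, 0, 0, 2 => [:: (1, ([:: Ge i1], [:: v21; v13])); (2, ([:: Ge i1], [:: v23]))]%R
  | 1, 0, 2, 1 => [:: (1, ([:: v32; v21], [:: Ge i2])); (-2, ([:: v31], [:: Ge i2]))]%R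
  | 0, 2, 2, 0 => [:: (-2, ([:: Ge i3], [:: Ge i1])); (-2, ([:: v32; v23], [:: Ge i1]));
      (-1, ([:: Ge i3], [:: v13; v31])); (-1, ([:: v31; v13], [:: Ge i1]))]%R
  | 1, 2, 2, 1 => [:: (-2, ([:: Ge i3], [:: Ge i2]));
      (-1, ([:: Ge i3], [:: v23; v32])); (-1, ([:: v32; v23], [:: Ge i2]))]%R
  | _, _, _, _ => [::]
  end%N.

Definition arrow_table (a b : arrow) : poly2 :=
  table (val a).1 (val a).2 (val b).1 (val b).2.

Definition arrow_bracket (a b : arrow) : poly2 :=
  arrow_table a b ++ lc_opp (swap2 (arrow_table b a)).

(** Twice the value [{{Phi_s, w}}] required of a moment map with
    component [P] at the vertex [s]. *)
Definition moment_poly (s : 'I_3) (P : poly1) (w : word) : poly2 :=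
  tens1 (mono (w ++ [:: Ge s])) P ++ lc_opp (tens1 (mono [:: Ge s]) (mul1 P (mono w)))
  ++ tens1 (mul1 (mono w) P) (mono [:: Ge s])
  ++ lc_opp (tens1 P (mono (Ge s :: w))).

(** The brackets with [gamma_3^-1] are opposite to those of a moment map. *)
Definition letter_bracket (x y : gen) : poly2 :=
  match x, y with
  | Gen_v a, Gen_v b => arrow_bracket a b
  | Gen_ginv i, Gen_v b => lc_opp (moment_poly i (mono [:: x]) [:: y])
  | _, _ => [::]
  end.

Definition good_letters (x y : gen) : bool :=
  match x, y with
  | (Gen_e _ | Gen_v _), (Gen_e _ | Gen_v _) => true
  | Gen_ginv i, Gen_v _ => i == i3
  | _, _ => false
  end.

Definition arrows : seq arrow := [:: a12; a13; a21; a23; a31; a32].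

Lemma arrows_all (P : pred arrow) : all P arrows -> forall a, P a.
Proof. by case/and5P=> ? ? ? ? /and3P[? ? _]; apply: arrowP. Qed.

Definition triple_check (a b c : arrow) : bool :=
  let u := [:: Gv a] in let v := [:: Gv b] in let w := [:: Gv c] in
  let gf := good_first good_letters in let br := sbr letter_bracket in
  [&& gf u (br v w), gf v (br w u), gf w (br u v)
    & balanced (nf3 (striple letter_bracket u v w ++ lc_opp (sqP u v w)))].

(** The quasi-Poisson identity on arrows, where both sides are a quarter of an
    integral combination of triples of paths. *)
Lemma triple_check_all a b c : triple_check a b c.
Proof.
move: a b c; have : all (fun a => all (fun b => all (triple_check a b) arrows) arrows) arrows.
  by vm_compute.
by move=> t a b c; exact: (arrows_all (arrows_all (arrows_all t a) b) c).
Qed.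

(** * Moment maps *)

Section Moment.
Variables (k : fieldType) (A : algType k).

(** Twice the right-hand side of the moment map condition; it is the inner
    derivation given by [e (x) x + x (x) e]. *)
Definition moment (e x a : A) : tensor A A :=
  outer a (tens e x + tens x e) 1 - outer 1 (tens e x + tens x e) a.

Lemma momentE e x a : moment e x a =
  tens (a * e) x - tens e (x * a) + tens (a * x) e - tens x (e * a).
Proof.
rewrite /moment !outerD !outer_tens !(mul1r, mulr1) opprD.
by rewrite addrACA addrA.
Qed.

Lemma moment_der e x : @derivation k A (outer_bimodule A) (moment e x).
Proof. exact: (@inner_der _ _ (outer_bimodule A)). Qed.

(** The moment map condition changes sign under inversion: [moment e x] is the
    inner derivation of [e (x) x + x (x) e], and multiplying this tensor by [y] on
    both sides inside gives [y (x) e + e (x) y] again. *)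
Lemma moment_inv (I : finType) (eI : I -> A) br s (x y : A) a c :
  double_bracket eI br -> 
  eI s * x = x -> x * eI s = x -> eI s * y = y -> y * eI s = y ->
  x * y = eI s -> y * x = eI s ->
  br x a = c *: moment (eI s) x a -> br y a = - c *: moment (eI s) y a.
Proof.
move=> brP ex xe ey ye xy yx bx.
rewrite (der_inv (br_inner_der brP a) _ xy yx ye) ?(br_0e brP) //= bx.
rewrite inner_inner !mulr1 innerZ scaleNr; congr (- (_ *: _)).
rewrite !momentE !(innerD, innerN, inner_tens) (mulrA y x a) (mulrA y _ a).
rewrite -(mulrA a x y) -(mulrA a _ y) ey ye xy yx.
by rewrite [LHS](ACl (3*4*1*2)).
Qed.
End Moment.

Lemma ev_moment (k : fieldType) (A : algType k) (g : gen -> A) s P w :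
  lincomb (evt2 g) (moment_poly s P w) =
  moment (g (Ge s)) (lincomb (evw g) P) (evw g w).
Proof.
rewrite momentE /moment_poly lincomb_cat ev_tens1 lincomb_cat lincomb_opp ev_tens1.
rewrite lincomb_cat lincomb_opp !ev_tens1 !ev_mul1 !ev_mono evw_cat evw1 evw_cons.
by rewrite !addrA.
Qed.

Section BoalchBracket.
Variables (k : fieldType) (br : boalch k -> boalch k -> tensor (boalch k) (boalch k)).
Hypothesis brP : double_bracket (be k) br.

Local Notation A := (boalch k).
Local Notation g := (bgen k).
Local Notation ev1 := (lincomb (evw g)).
Local Notation ev2 := (lincomb (evt2 g)).
Local Notation h := (2^-1 : k).

Hypothesis br_arrows : forall a b, br (bv k a) (bv k b) = h *: ev2 (arrow_bracket a b).

Let gP : boalch_family g := @bgen_family k.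
Let pP : path_family g := @bgen_path k.

Definition arrow_letter (x : gen) := if x is (Gen_e _ | Gen_v _) then true else false.

Let br_letters x y : arrow_letter x && arrow_letter y ->
  br (g x) (g y) = h *: ev2 (letter_bracket x y).
Proof.
case/andP; case: x => [i|a|a|i|i] // _; case: y => [j|b|b|j|j] // _;
  rewrite /= ?lincomb_nil ?scaler0; last exact: br_arrows.
- exact: (br_0e brP).
- exact: (br_0e brP).
- exact: (br_e0 brP).
Qed.

(** Both sides are derivations that vanish on the idempotents. *)
Lemma moment_ext s x : (forall a, br x (bv k a) = h *: moment (be k s) x (bv k a)) ->
  be k s * x = x -> x * be k s = x ->
  forall a, br x a = h *: moment (be k s) x a.
Proof.
move=> bx ex xe; apply: (@der_ext _ (outer_bimodule A)).
- exact: br_outer_der brP x.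
- have dm := moment_der (be k s) x; split=> [c a b|a b].
    by rewrite (der_lin dm) scalerDr !scalerA mulrC.
  by rewrite (der_leibniz dm) scalerDr (bilinZr (lact_bilin _)) (bilinZl (ract_bilin _)).
- move=> t; rewrite (br_e0 brP) momentE.
  have te : be k t * be k s = if s == t then be k s else 0.
    by rewrite /be (path_e pP) eq_sym; case: eqP => // ->.
  have et : be k s * be k t = if s == t then be k s else 0 by exact: (path_e pP).
  rewrite te et -{2}xe -mulrA et -{3}ex mulrA te; case: eqP => _.
    by rewrite xe ex subrr add0r subrr scaler0.
  by rewrite mulr0 mul0r !(tens0l, tens0r) !(subr0, addr0) scaler0.
- exact: bx.
Qed.

Definition gamma3_exp : rexp :=
  RD (RD (RX (Ge i3)) (RM (RX v31) (RX v13))) (RM (RX v32) (RX v23)).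

Definition ginv1_exp : rexp :=
  RD (RD (RX (Ge i1)) (RM (RX v12) (RX v21)))
     (RM (RD (RX v13) (RN (RM (RX v12) (RX v23))))
         (RD (RX v31) (RN (RM (RX v32) (RX v21))))).

Lemma ev_gamma3 : ev1 (rnorm gamma3_exp) = bg k i3.
Proof. by rewrite rnormE [bg _ _](gamma3E gP). Qed.

Lemma ev_ginv1 : ev1 (rnorm ginv1_exp) = bginv k i1.
Proof. by rewrite rnormE [bginv _ _](ginv1E gP). Qed.

(** Decides the moment map condition on an arrow for a polynomial [P] in the arrows,
    up to the factor [c]: this is 1 for [gamma_3] and -1 for [gamma_1^-1]. *)
Definition moment_check (s : 'I_3) (c : int) (P : poly1) (a : arrow) : bool :=
  all (fun p => allrel (fun x y => arrow_letter x && arrow_letter y) p.2 [:: Gv a]) P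
  && balanced (nf2 (sbr1 letter_bracket P [:: Gv a]
       ++ lc_opp [seq (c * p.1, p.2) | p <- moment_poly s P [:: Gv a]])).

Lemma moment_checkP s c P a : moment_check s c P a ->
  br (ev1 P) (bv k a) = (h *~ c) *: moment (be k s) (ev1 P) (bv k a).
Proof.
case/andP=> good /(ev2_eq pP); rewrite lincomb_scale ev_moment evw1 => eqP.
have := sbr1P brP br_letters good; rewrite eqP evw1 => ->.
by rewrite -scaler_int scalerA mulrzr.
Qed.

Lemma moment_gamma3 a : br (bg k i3) a = h *: moment (be k i3) (bg k i3) a.
Proof.
apply: moment_ext; [|exact: (path_src pP (Gg i3))|exact: (path_tgt pP (Gg i3))].
move=> {}a; have chk : moment_check i3 1 (rnorm gamma3_exp) a.
  by move: a; apply: arrows_all; vm_compute.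
by have := moment_checkP chk; rewrite ev_gamma3.
Qed.

Lemma moment_gamma1 a : br (bg k i1) a = h *: moment (be k i1) (bg k i1) a.
Proof.
case/boalch_familyP: (gP) => _ _ gV Vg _.
apply: moment_ext; [|exact: (path_src pP (Gg i1))|exact: (path_tgt pP (Gg i1))].
move=> {}a; have chk : moment_check i1 (-1) (rnorm ginv1_exp) a.
  by move: a; apply: arrows_all; vm_compute.
have := moment_checkP chk; rewrite ev_ginv1 mulrN1z.
move=> /(moment_inv brP (path_src pP (Gi i1)) (path_tgt pP (Gi i1))
  (path_src pP (Gg i1)) (path_tgt pP (Gg i1)) (Vg i1) (gV i1)) ->.
by rewrite opprK.
Qed.

Lemma br_ginv3 a : br (bginv k i3) a = - h *: moment (be k i3) (bginv k i3) a.
Proof.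
case/boalch_familyP: (gP) => _ _ gV Vg _.
apply: (moment_inv brP) (moment_gamma3 a).
- exact: (path_src pP (Gg i3)).
- exact: (path_tgt pP (Gg i3)).
- exact: (path_src pP (Gi i3)).
- exact: (path_tgt pP (Gi i3)).
- exact: gV.
- exact: Vg.
Qed.

Lemma br_good_letters x y : good_letters x y ->
  br (g x) (g y) = h *: ev2 (letter_bracket x y).
Proof.
case: x => [i|a|a|i|i] //; first by move=> ey; apply: br_letters; case: y ey.
- by move=> ey; apply: br_letters; case: y ey.
case: y => // b /eqP ->.
have -> : letter_bracket (Gi i3) (Gv b) =
  lc_opp (moment_poly i3 (mono [:: Gi i3]) [:: Gv b]) by [].
by rewrite lincomb_opp ev_moment ev_mono !evw1 [LHS]br_ginv3 scalerN scaleNr.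
Qed.

(** The identity is extended from arrows to all elements in the last argument, and
    a cyclic permutation then brings the next argument to the last place. *)
Lemma quasi_Poisson_boalch : quasi_Poisson (be k) br.
Proof.
pose M := outer3_bimodule A.
have eP : orthogonal_idempotents (be k).
  split=> [s t|]; first exact: (path_e pP).
  by case/boalch_familyP: (gP).
have ext a b : (forall c, triple_bracket br a b (bv k c) = qP_bracket (be k) a b (bv k c)) ->
    forall c, triple_bracket br a b c = qP_bracket (be k) a b c.
  move=> abv; apply: (@der_ext _ M) => //.
  - exact: triple_der brP a b.
  - exact: qP_der.
  - by move=> i; rewrite (triple_e brP) (qP_e eP).
have arrows_eq a b c : triple_bracket br (bv k a) (bv k b) (bv k c) =
    qP_bracket (be k) (bv k a) (bv k b) (bv k c).
  have /and4P[gu gv gw /(ev3_eq pP) eqT] := triple_check_all a b c.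
  rewrite /bv -!(evw1 g) (stripleP brP br_good_letters) // eqT [RHS]ev_sqP.
  by rewrite -invfM -natrM.
have cyc a b c : triple_bracket br a b c = qP_bracket (be k) a b c ->
    triple_bracket br b c a = qP_bracket (be k) b c a.
  by move=> T; rewrite [LHS]triple_cyclic T [RHS]qP_cyclic.
have two_arrows a b c := ext _ _ (arrows_eq a b) c.
have one_arrow a b c : triple_bracket br (bv k a) b c = qP_bracket (be k) (bv k a) b c.
  by apply: ext => d; apply/cyc/two_arrows.
by move=> a b; apply: ext => c; apply/cyc/one_arrow.
Qed.

Definition LU23_exp : rexp := RD (RX v23) (RM (RX v21) (RX v13)).
Definition LU32_exp : rexp := RD (RX v32) (RM (RX v31) (RX v12)).
Definition gamma2_exp : rexp :=
  RD (RD (RX (Ge i2)) (RM (RX v21) (RX v12)))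
     (RN (RM LU23_exp (RM (RX (Gi i3)) LU32_exp))).

Lemma ev_gamma2 : ev1 (rnorm gamma2_exp) = bg k i2.
Proof. by rewrite rnormE [bg _ _](gamma2E gP) [X in _ - _ * X](w32E gP). Qed.

(** The moment map condition for [gamma_2] holds in the path algebra with
    [gamma_3^-1] adjoined, but not among words: it also uses
    [gamma_3^-1 gamma_3 = e_3 = gamma_3 gamma_3^-1].  The hints are the multiples
    of these relations by which the two sides differ. *)
Definition right_hint (w : word) : poly2 :=
  tens1 (mono w)
    (rnorm (RM LU23_exp (RD (RX (Ge i3)) (RN (RM (RX (Gi i3)) gamma3_exp))))).

Definition left_hint (w : word) : poly2 :=
  tens1 (rnorm (RM (RD (RX (Ge i3)) (RN (RM gamma3_exp (RX (Gi i3))))) LU32_exp))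
    (mono w).

Lemma ev_right_hint w : ev2 (right_hint w) = 0.
Proof.
case/boalch_familyP: (gP) => _ _ gV Vg _.
rewrite ev_tens1 [X in tens _ X]rnormE.
rewrite -[rexp_eval g _]/(rexp_eval g LU23_exp *
  (be k i3 - bginv k i3 * rexp_eval g gamma3_exp)).
by rewrite -(rnormE g gamma3_exp) ev_gamma3 [_ * bg _ _]Vg subrr mulr0 tens0r.
Qed.

Lemma ev_left_hint w : ev2 (left_hint w) = 0.
Proof.
case/boalch_familyP: (gP) => _ _ gV Vg _.
rewrite ev_tens1 [X in tens X _]rnormE.
rewrite -[rexp_eval g _]/((be k i3 - rexp_eval g gamma3_exp * bginv k i3) *
  rexp_eval g LU32_exp).
by rewrite -(rnormE g gamma3_exp) ev_gamma3 [bg _ _ * _]gV subrr mul0r tens0l.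
Qed.

Lemma moment_gamma2 a : br (bg k i2) a = h *: moment (be k i2) (bg k i2) a.
Proof.
apply: moment_ext; [|exact: (path_src pP (Gg i2))|exact: (path_tgt pP (Gg i2))].
pose P := rnorm gamma2_exp.
have goodP b : all (fun p => allrel good_letters p.2 [:: Gv b]) P.
  by move: b; apply: arrows_all; vm_compute.
have key b l : ev2 l = 0 ->
    balanced (nf2 (sbr1 letter_bracket P [:: Gv b]
       ++ lc_opp (moment_poly i2 P [:: Gv b] ++ l))) ->
    br (bg k i2) (bv k b) = h *: moment (be k i2) (bg k i2) (bv k b).
  move=> l0 /(ev2_eq pP); rewrite lincomb_cat l0 addr0 ev_moment evw1 ev_gamma2 => eqP.
  by have := sbr1P brP br_good_letters (goodP b); rewrite eqP evw1 ev_gamma2.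
(* Twice, because brackets of arrows are halves of integral combinations. *)
have ev2_twice l : ev2 l = 0 -> ev2 (l ++ l) = 0.
  by rewrite lincomb_cat => ->; rewrite addr0.
have ev2_opp l : ev2 l = 0 -> ev2 (lc_opp l) = 0.
  by rewrite lincomb_opp => ->; rewrite oppr0.
apply: arrowP.
- by apply: (key _ [::]); [exact: lincomb_nil | vm_compute].
- apply: key (ev2_twice _ (ev_right_hint [:: v12])) _; by vm_compute.
- by apply: (key _ [::]); [exact: lincomb_nil | vm_compute].
- apply: key (ev2_twice _ (ev_right_hint [:: Ge i2])) _; by vm_compute.
- apply: key (ev2_opp _ (ev2_twice _ (ev_left_hint [:: v21]))) _; by vm_compute.
- apply: key (ev2_opp _ (ev2_twice _ (ev_left_hint [:: Ge i2]))) _; by vm_compute.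
Qed.

Lemma Hamiltonian_boalch :
  Hamiltonian_dqP (be k) br (bg k i1 + bg k i2 + bg k i3).
Proof.
case/boalch_familyP: (gP) => _ sum_e gV Vg _.
have eP : orthogonal_idempotents (be k) by split=> // s t; exact: (path_e pP).
split=> //; first exact: quasi_Poisson_boalch.
have bgbi s t : bg k s * bginv k t = if s == t then be k s else 0.
  case: eqP => [->|/eqP neq_st]; first exact: gV.
  exact: (g_mul0 pP (x := Gg s) (y := Gi t)).
have bibg s t : bginv k s * bg k t = if s == t then be k s else 0.
  case: eqP => [->|/eqP neq_st]; first exact: Vg.
  exact: (g_mul0 pP (x := Gi s) (y := Gg t)).
split.
  exists (\sum_s bginv k s); rewrite -sum_ord3.
  split; rewrite mulr_suml -[RHS]sum_e; apply: eq_bigr => s _; rewrite mulr_sumr.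
    by rewrite (bigD1 s) //= bgbi eqxx big1 ?addr0 // => t /negbTE; rewrite eq_sym bgbi => ->.
  by rewrite (bigD1 s) //= bibg eqxx big1 ?addr0 // => t /negbTE; rewrite eq_sym bibg => ->.
exists (bg k); split=> [|s|a s].
- by rewrite sum_ord3.
- exists (bg k s); rewrite [be k s * _](path_src pP (Gg s)).
  by rewrite [_ * be k s](path_tgt pP (Gg s)).
- rewrite -momentE; elim/ord3P: s.
  + exact: moment_gamma1.
  + exact: moment_gamma2.
  + exact: moment_gamma3.
Qed.

End BoalchBracket.

(** * Existence and uniqueness of the bracket *)

Section Existence.
Variable k : fieldType.

Local Notation A := (boalch k).
Local Notation T2 := (tensor A A).
Local Notation g := (bgen k).
Local Notation ev2 := (lincomb (evt2 g)).
Local Notation h := (2^-1 : k).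

Let gP : boalch_family g := @bgen_family k.
Let pP : path_family g := @bgen_path k.

(** A double bracket is determined by its values on pairs of arrows: first the
    second argument is released, then the first. *)
Lemma br_ext (br br' : A -> A -> T2) :
  double_bracket (be k) br -> double_bracket (be k) br' ->
  (forall a b, br (bv k a) (bv k b) = br' (bv k a) (bv k b)) ->
  forall x y, br x y = br' x y.
Proof.
move=> brP brP' eq_v x y.
have eq_vy a : br (bv k a) =1 br' (bv k a).
  apply: (@der_ext _ (outer_bimodule A)); first exact: br_outer_der brP _.
  - exact: br_outer_der brP' _.
  - by move=> i; rewrite (br_e0 brP) (br_e0 brP').
  - exact: eq_v.
apply: (@der_ext _ (inner_bimodule A) (br^~ y) (br'^~ y)).
- exact: br_inner_der brP _.
- exact: br_inner_der brP' _.
- by move=> i; rewrite (br_0e brP) (br_0e brP').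
- by move=> a; exact: eq_vy.
Qed.

Definition arrow_value (a b : arrow) : T2 := h *: ev2 (arrow_bracket a b).

Lemma arrow_value_outer a b :
  outer (be k (val b).1) (arrow_value a b) 1 = arrow_value a b /\
  outer 1 (arrow_value a b) (be k (val b).2) = arrow_value a b.
Proof.
rewrite /arrow_value !outerZ /be -!(evw1 g) -{2}(evw_nil g) -{1}(evw_nil g) -!ev_outer2s.
split; congr (_ *: _); apply: (ev2_eq pP); move: a b.
  by move=> a; apply: arrows_all; move: a; apply: arrows_all; vm_compute.
by move=> a; apply: arrows_all; move: a; apply: arrows_all; vm_compute.
Qed.

Lemma arrow_value_inner a b :
  inner (be k (val a).1) (arrow_value a b) 1 = arrow_value a b /\
  inner 1 (arrow_value a b) (be k (val a).2) = arrow_value a b.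
Proof.
rewrite /arrow_value !innerZ /be -!(evw1 g) -{2}(evw_nil g) -{1}(evw_nil g) -!ev_inner2s.
split; congr (_ *: _); apply: (ev2_eq pP); move: a b.
  by move=> a; apply: arrows_all; move: a; apply: arrows_all; vm_compute.
by move=> a; apply: arrows_all; move: a; apply: arrows_all; vm_compute.
Qed.

Lemma arrow_value_antisym a b : arrow_value a b = - tau12 (arrow_value b a).
Proof.
rewrite /arrow_value tau12Z -scalerN; congr (_ *: _).
rewrite /arrow_bracket !lincomb_cat !lincomb_opp !ev_swap2 tau12D.
by rewrite tau12N tau12K opprD opprK addrC.
Qed.

(** For an arrow [a], [d a] is the outer derivation with the prescribed values on
    arrows; for each [y], [D y] is then the inner derivation sending every arrow [a]
    to [d a y].  The bracket is [br x y = D y x]; that it is a derivation in [y]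
    for all [x] is proved by induction on [x]. *)
Lemma boalch_bracket_exists :
  exists br : A -> A -> T2, double_bracket (be k) br /\
    forall a b, br (bv k a) (bv k b) = arrow_value a b.
Proof.
pose Mo := outer_bimodule A; pose Mi := inner_bimodule A.
have /choice[d dP] a : exists D : A -> Mo,
    [/\ derivation D, forall i, D (be k i) = 0 & forall b, D (bv k b) = arrow_value a b].
  by apply: (@der_exists _ Mo) => b; have [] := arrow_value_outer a b.
have d_corner a x : inner (be k (val a).1) (d a x) 1 = d a x /\
    inner 1 (d a x) (be k (val a).2) = d a x.
  have [dd de dv] := dP a.
  have inner_d y z : derivation (fun x => inner y (d a x) z : Mo).
    split=> [c u v|u v]; first by rewrite (der_lin dd) innerD innerZ.
    by rewrite (der_leibniz dd) /= innerD !inner_outer.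
  split.
    apply: (der_ext (inner_d _ _) dd) => [i|b]; first by rewrite de inner0.
    by rewrite dv; have [] := arrow_value_inner a b.
  apply: (der_ext (inner_d _ _) dd) => [i|b]; first by rewrite de inner0.
  by rewrite dv; have [] := arrow_value_inner a b.
have /choice[D DP] y : exists D : A -> Mi,
    [/\ derivation D, forall i, D (be k i) = 0 & forall a, D (bv k a) = d a y].
  by apply: (@der_exists _ Mi) => a; have [] := d_corner a y.
pose br x y : T2 := D y x.
have br_v a y : br (bv k a) y = d a y by rewrite /br; have [_ _ ->] := DP y.
have br_e i y : br (be k i) y = 0 by rewrite /br; have [_ -> _] := DP y.
have br_lin y : linear (br^~ y) by have [dD _ _] := DP y; exact: (der_lin dD).
have br_leib y a b : br (a * b) y = inner a (br b y) 1 + inner 1 (br a y) b.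
  by have [dD _ _] := DP y; exact: (der_leibniz dD).
have br_der x : derivation (br x : A -> Mo).
  elim/boalch_ind: x => [u v du dv|c u du|u v du dv|i|a|i dgi].
  - have brD y : br (u + v) y = br u y + br v y by have [dD _ _] := DP y; exact: (derD dD).
    split=> [c a b|a b]; rewrite !brD.
      by rewrite (der_lin du) (der_lin dv) scalerDr addrACA.
    by rewrite (der_leibniz du) (der_leibniz dv) /= !outerD addrACA.
  - have brZ y : br (c *: u) y = c *: br u y by have [dD _ _] := DP y; exact: (derZ dD).
    split=> [x a b|a b]; rewrite !brZ.
      by rewrite (der_lin du) scalerDr !scalerA mulrC.
    by rewrite (der_leibniz du) /= !outerZ scalerDr.
  - split=> [c a b|a b]; rewrite !br_leib.
      by rewrite (der_lin du) (der_lin dv) !(innerD, innerZ) scalerDr addrACA.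
    by rewrite (der_leibniz du) (der_leibniz dv) /= !(innerD, outerD) !inner_outer addrACA.
  - split=> [c a b|a b]; rewrite !br_e; first by rewrite scaler0 addr0.
    by rewrite /= !outer0 addr0.
  - have [dd _ _] := dP a.
    split=> [c x y|x y]; rewrite !br_v; first exact: (der_lin dd).
    exact: (der_leibniz dd).
  - have br_inv y : br (bginv k i) y =
        - inner (bginv k i) (inner 1 (br (bg k i) y) (bginv k i)) 1.
      case/boalch_familyP: (gP) => _ _ gV Vg _; have [dD De _] := DP y.
      exact: (der_inv dD (De i) (gV i) (Vg i) (path_tgt pP (Gi i))).
    have dc y z : derivation (fun x => - inner y (br (bg k i) x) z : Mo).
      split=> [c u v|u v].
        by rewrite (der_lin dgi) innerD innerZ opprD scalerN.
      rewrite (der_leibniz dgi) /= innerD !inner_outer opprD.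
      by rewrite !outerN.
    have dc' := dc (bginv k i) (bginv k i).
    split=> [c x y|x y]; rewrite !br_inv !inner_inner !(mulr1, mul1r).
      exact: (der_lin dc').
    exact: (der_leibniz dc').
exists br.
have br_vv a b : br (bv k a) (bv k b) = arrow_value a b by rewrite br_v; have [_ _ ->] := dP a.
have base0 (V : lmodType k) (F : A -> V) x : linear F -> (forall i, F (be k i) = 0) ->
    in_base (be k) x -> F x = 0.
  move=> linF Fe [c ->].
  have FD u v : F (u + v) = F u + F v by have := linF 1 u v; rewrite !scale1r.
  have F0 : F 0 = 0 by apply: (addrI (F 0)); rewrite -FD !addr0.
  rewrite (big_morph _ FD F0) big1 // => i _.
  by have := linF (c i) (be k i) 0; rewrite Fe F0 !addr0 scaler0.
have br_e' x i : br x (be k i) = 0.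
  have [dD De Dv] := DP (be k i).
  apply: (der_ext dD (der_zero Mi)) => // a.
  by rewrite Dv; have [_ -> _] := dP a.
have br_anti x y : br x y = - tau12 (br y x).
  have [dDy _ _] := DP y.
  apply: (der_ext dDy (tau12_der_outer (br_der y))) => [i|a].
    by rewrite [D _ _]br_e br_e' tau12_0 oppr0.
  have [dDa _ _] := DP (bv k a).
  apply: (der_ext (br_der (bv k a)) (tau12_der_inner dDa)) => [i|b].
    by rewrite br_e' [D _ _]br_e tau12_0 oppr0.
  by rewrite br_vv [D _ _]br_vv arrow_value_antisym.
split=> //; split=> //.
- by split=> [y|x]; [exact: br_lin | exact: (der_lin (br_der x))].
- by move=> x y; apply: (base0 _ (br^~ y)).
- by move=> x y; apply: (base0 _ (br x)) => //; exact: (der_lin (br_der x)).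
- by move=> x y z; rewrite (der_leibniz (br_der x)) addrC.
Qed.

End Existence.

(** * The prescribed values *)

Section Values.
Variables (k : fieldType) (char0 : [pchar k] =i pred0).

Local Notation A := (boalch k).
Local Notation T2 := (tensor A A).
Local Notation g := (bgen k).
Local Notation ev2 := (lincomb (evt2 g)).
Local Notation h := (2^-1 : k).

(** The table of brackets holds the doubles of the prescribed values. *)
Lemma half_double (V : lmodType k) (x : V) : h *: (x *~ 2) = x.
Proof.
rewrite -scaler_int scalerA mulVf ?scale1r //.
by change (2%:R != 0 :> k); rewrite ((pcharf0P k).1 char0).
Qed.

Lemma arrow_values (br : A -> A -> T2) :
  (forall a b, br (bv k a) (bv k b) = arrow_value k a b) -> boalch_bracket_values br.
Proof.
move=> br_v; rewrite /boalch_bracket_values /=.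
have ev0 : ev2 [::] = 0 by exact: lincomb_nil.
split; [|split|split|split|split]; first by apply: arrowP; rewrite br_v /arrow_value
  /arrow_bracket /arrow_table /= ev0 scaler0.
all: rewrite br_v /arrow_value /arrow_bracket /arrow_table /=.
all: rewrite !lincomb_cons lincomb_nil /evt2 /= !evw_cons evw_nil !mulr1.
all: rewrite !(half_double, mulr1z, mulrN1z, mulrNz, scalerDr, scalerN, scaleNr).
all: by rewrite scaler0 addr0 ?opprD ?addrA.
Qed.

(** The prescribed values cover each unordered pair of distinct arrows. *)
Lemma values_inj (br br' : A -> A -> T2) :
  double_bracket (be k) br -> double_bracket (be k) br' ->
  boalch_bracket_values br -> boalch_bracket_values br' ->
  forall a b, br (bv k a) (bv k b) = br' (bv k a) (bv k b).
Proof.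
move=> brP brP' [d0 [b1 b2 b3 b4] [b5 b6 b7 b8] [b9 b10 b11 b12] [b13 b14 b15]].
move=> [d0' [c1 c2 c3 c4] [c5 c6 c7 c8] [c9 c10 c11 c12] [c13 c14 c15]].
have sym a b : br (bv k b) (bv k a) = br' (bv k b) (bv k a) ->
    br (bv k a) (bv k b) = br' (bv k a) (bv k b).
  by move=> ba; rewrite (br_antisym brP) ba -(br_antisym brP').
pose bE := (d0, b1, b2, b3, b4, b5, b6, b7, (b8, b9, b10, b11, b12, b13, b14, b15)).
pose cE := (d0', c1, c2, c3, c4, c5, c6, c7, (c8, c9, c10, c11, c12, c13, c14, c15)).
by apply: arrowP; apply: arrowP; rewrite ?bE ?cE //; apply: sym; rewrite bE cE.
Qed.

End Values.

Theorem theorem4p5 (k : fieldType) (char0 : [pchar k] =i pred0) :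
  (exists! br : boalch k -> boalch k -> tensor (boalch k) (boalch k),
     double_bracket (be k) br /\ boalch_bracket_values br) /\
  (forall br : boalch k -> boalch k -> tensor (boalch k) (boalch k),
     double_bracket (be k) br -> boalch_bracket_values br ->
     Hamiltonian_dqP (be k) br (bg k i1 + bg k i2 + bg k i3)).
Proof.
have [br0 [brP0 br0_v]] := boalch_bracket_exists k.
have br0_vals := arrow_values char0 br0_v.
have br_v br : double_bracket (be k) br -> boalch_bracket_values br ->
    forall a b, br0 (bv k a) (bv k b) = br (bv k a) (bv k b).
  by move=> brP; apply: values_inj.
split=> [|br brP br_vals].
  exists br0; split=> // br [brP br_vals].
  apply/funext => x; apply/funext => y; apply: (br_ext brP0 brP).
  exact: br_v.
by apply: Hamiltonian_boalch => // a b; rewrite -br_v.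
Qed.
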